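(* For all integers $k\ge 1$ and $n\geq k+1$, $$R(P_n, P_n^k)= (n-1)k + \left\lfloor \frac{n}{k+1} \right\rfloor.$$
   Context: For graphs $G$ and $H$, the Ramsey number $R(G,H)$ is the minimum $N$ such that every colouring of the edges of $K_N$ with the colours red and blue contains either a red copy of $G$ or a blue copy of $H$ (copies are not necessarily induced subgraphs). $P_n$ is the path on $n$ vertices, and $P_n^k$, the $k$th power of the path on $n$ vertices, is the graph with vertex set $\{1,\dots,n\}$ in which $ij$ is an edge whenever $1\leq |i-j|\leq k$. *)

(* Defs.v *)
From mathcomp Require Import all_boot all_order all_algebra.
Import IntDist.

Set Implicit Arguments.
Unset Strict Implicit.
Unset Printing Implicit Defensive.

Record sgraph := SGraph {
  svertex :> finType;
  sedge : rel svertex;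
  sedge_sym : symmetric sedge;
  sedge_irrefl : irreflexive sedge }.

(* Not necessarily induced. *)
Definition contains_copy (G F : sgraph) : Prop :=
  exists2 f : G -> F, injective f & forall x y, sedge x y -> sedge (f x) (f y).

Section ColourClass.

(* A colouring of the edges of K_N is given by a function on subsets of 'I_N;
   its values on sets that are not pairs of distinct vertices are never used. *)
Variables (N : nat) (c : {set 'I_N} -> bool) (b : bool).

Definition colour_class_rel : rel 'I_N :=
  fun x y => (x != y) && (c [set x; y] == b).

Lemma colour_class_sym : symmetric colour_class_rel.
Proof. by move=> x y; rewrite /colour_class_rel eq_sym setUC. Qed.

Lemma colour_class_irrefl : irreflexive colour_class_rel.
Proof. by move=> x; rewrite /colour_class_rel eqxx. Qed.

Definition colour_class : sgraph :=
  SGraph colour_class_sym colour_class_irrefl.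

End ColourClass.

(* The colour true is red and the colour false is blue. *)
Definition arrows (N : nat) (G H : sgraph) : Prop :=
  forall c : {set 'I_N} -> bool,
    contains_copy G (colour_class c true) \/
    contains_copy H (colour_class c false).

Definition is_ramsey_number (G H : sgraph) (N : nat) : Prop :=
  arrows N G H /\ forall M : nat, arrows M G H -> N <= M.

(* The vertices 1, ..., n are represented by 0, ..., n - 1. *)
Section Paths.

Variable n : nat.

Definition path_rel : rel 'I_n :=
  fun i j => (i.+1 == j :> nat) || (j.+1 == i :> nat).

Lemma path_rel_sym : symmetric path_rel.
Proof. by move=> i j; rewrite /path_rel orbC. Qed.

Lemma path_rel_irrefl : irreflexive path_rel.
Proof. by move=> i; rewrite /path_rel orbb gtn_eqF. Qed.

Definition path_graph : sgraph := SGraph path_rel_sym path_rel_irrefl.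

Variable k : nat.

Definition path_power_rel : rel 'I_n := fun i j => 1 <= `|i - j|%N <= k.

Lemma path_power_rel_sym : symmetric path_power_rel.
Proof. by move=> i j; rewrite /path_power_rel distnC. Qed.

Lemma path_power_rel_irrefl : irreflexive path_power_rel.
Proof. by move=> i; rewrite /path_power_rel distnn. Qed.

Definition path_power : sgraph :=
  SGraph path_power_rel_sym path_power_rel_irrefl.

End Paths.

(* Main.v *)
Require Import Defs.
From mathcomp Require Import all_boot zify.

Set Implicit Arguments.
Unset Strict Implicit.
Unset Printing Implicit Defensive.

(** Write m for n - 1 and f for n / (k + 1), rounded down.

    Lower bound. Partition fewer than k m + f vertices into k parts of at most m
    vertices and one part of fewer than f vertices, and let red be the edges
    inside the parts. A red path stays in one part, which is too small. Any k + 1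
    consecutive vertices of a blue P_n^k lie in different parts, so its f disjoint
    blocks of k + 1 consecutive vertices need f vertices in the small part.

    Upper bound. Let [e] be the red graph and suppose that no red path has n
    vertices. Arrange P_n^k as a table whose column t is the t-th block of k + 1
    consecutive vertices. Row number i then has f + 1 entries if i < n mod (k + 1)
    and f entries otherwise. Two entries are adjacent exactly when they lie in
    different rows, and either in the same column or in consecutive columns with
    the one in the later column belonging to the earlier row. A blue P_n^k is thus
    a family of k + 1 disjoint rows any two of which are related by [zigzag].

    The induction needs partial tables: a set of at least m q + s vertices contains
    q rows of prescribed lengths (f or f + 1, not increasing) and one last row of
    length s that begins in column o ([woven], [weaving]). For q = k, o = 0, s = f
    this is the upper bound. The induction is on the set A of vertices.

    If A is the union of two nonempty sets B and C without red edges between them,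
    neither of which suffices alone, then write #|B| = m i + s0 with s0 < m. If
    s0 <= s, then B supplies i rows and C supplies q - i rows, and the short row
    starts in B and is continued in C where the contribution of B ends; this is
    what the offset o is for ([woven_cat]). If s0 > s, then one of the two sets has
    enough vertices to supply its short row at full length ([woven_insert]).

    If q = 1, then the theorem of Gerencser and Gyarfas provides a blue path with
    2 s or 2 s + 1 vertices, which belong alternately to the two rows.

    If red is connected on A and q >= 2, then there are q + 1 sets of the prescribed
    sizes with only blue edges between them. For q >= 3 they are cut off one after
    the other by a red depth-first search ([connected_multipartite]): each set
    costs only the vertices of the search stack, and for the first three sets
    together these are fewer than 2 m, because the stacks can be joined to paths.
    For q = 2 this cost is too high. Instead a red path P and a set C are chosen
    such that the components outside P have as little excess over a threshold t as
    possible. If some excess remains, then the components that arise when either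
    end of P is removed from P, together with C, are three large sets without red
    edges between them, as otherwise P could be rerouted so as to enter C. If no
    excess remains, then the components are small enough to be grouped greedily
    ([connected_tripartite]). *)

(** * Long paths in a graph or in its complement *)

Definition has_path (T : finType) (e : rel T) (A : {set T}) (n : nat) : Prop :=
  exists p, [/\ uniq p, sorted e p, {subset p <= A} & size p = n].

Fixpoint pairs (T : Type) (s : seq T) : seq (T * T) :=
  if s is x :: y :: s' then (x, y) :: pairs s' else [::].

Fixpoint unpair (T : Type) (ps : seq (T * T)) : seq T :=
  if ps is (x, y) :: ps' then [:: x, y & unpair ps'] else [::].

Lemma pair_ind (T : Type) (P : seq T -> Prop) :
  P [::] -> (forall x, P [:: x]) ->
  (forall x y s, P s -> P (x :: y :: s)) -> forall s, P s.
Proof.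
move=> P0 P1 PS s; have [m] := ubnP (size s).
elim: m s => // m IH [|x [|y s]] //= lt_s.
by apply: PS; apply: IH; lia.
Qed.

Lemma size_pairs (T : Type) (s : seq T) : size (pairs s) = (size s)./2.
Proof. by elim/pair_ind: s => //= x y s ->. Qed.

Lemma unpair_subseq (T : eqType) (s : seq T) : subseq (unpair (pairs s)) s.
Proof.
elim/pair_ind: s => // x y s IH.
by rewrite /= !eqxx.
Qed.

Lemma mem_pairs (T : eqType) (s : seq T) u v :
  (u, v) \in pairs s -> exists s1 s2, s = s1 ++ u :: v :: s2.
Proof.
elim/pair_ind: s => // x y s IH /=; rewrite inE => /orP[/eqP[-> ->]|/IH].
  by exists [::], s.
by move=> [s1 [s2 ->]]; exists (x :: y :: s1), s2.
Qed.

(** Both ends have to lie in [Z], so that either of them can be used to extend a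
    thread or to join it to another one. *)
Definition thread (T : eqType) (r : rel T) (Z : seq T) (Q : seq T) : bool :=
  if Q is a :: q then [&& path r a q, a \in Z & last a q \in Z] else false.

Lemma thread_join (T : eqType) (r : rel T) (Z : seq T) a q b q' w :
  symmetric r -> thread r Z (a :: q) -> thread r Z (b :: q') ->
  r a w -> r b w -> thread r Z (rev (a :: q) ++ w :: b :: q').
Proof.
move=> r_sym /and3P[pa a_Z la_Z] /and3P[pb b_Z lb_Z] aw bw.
rewrite lastI rev_rcons /= last_cat /= la_Z lb_Z cat_path rev_path.
rewrite (eq_path (e' := r)) ?pa /= => [|x y]; last exact: r_sym.
rewrite pb (r_sym w) bw !andbT.
by case: q {pa la_Z} => //= c q; rewrite rev_cons last_rcons.
Qed.

Lemma thread_sub (T : eqType) (r : rel T) (Z Z' Q : seq T) :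
  {subset Z <= Z'} -> thread r Z Q -> thread r Z' Q.
Proof. by move=> sZ; case: Q => //= a q /and3P[-> /sZ-> /sZ->]. Qed.

Lemma perm_merge (T : eqType) (X Y Q : seq T) w :
  perm_eq ((rev X ++ w :: Y) ++ Q) (w :: X ++ Y ++ Q).
Proof. by apply/permP=> p; rewrite /= !count_cat count_rev /=; lia. Qed.

(** Every [z] is related to one of the two members of a pair, so among
    the first vertices of three threads two are related to the same member, which
    joins their threads. Each further [z] is a third thread, which one pair
    removes again. *)
Lemma two_threads (T : eqType) (r : rel T) (zs : seq T) (ps : seq (T * T)) z0 z1 :
  symmetric r ->
  (forall z u v, z \in [:: z0, z1 & zs] -> (u, v) \in ps -> r z u || r z v) ->
  uniq ([:: z0, z1 & zs] ++ unpair ps) -> size ps = size zs ->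
  exists Q1 Q2, [/\ thread r [:: z0, z1 & zs] Q1, thread r [:: z0, z1 & zs] Q2,
    uniq (Q1 ++ Q2), {subset Q1 ++ Q2 <= [:: z0, z1 & zs] ++ unpair ps} &
    size (Q1 ++ Q2) = (size zs).*2.+2].
Proof.
move=> r_sym; elim: zs ps => [|z zs IH] [|[u v] ps] // dom Uzs sz.
  by exists [:: z0], [:: z1]; rewrite /thread ?inE !eqxx !orbT; split.
set Zs := [:: z0, z1, z & zs].
have sub0 : {subset [:: z0, z1 & zs] <= Zs}.
  by move=> x; rewrite !inE => /or3P[] ->; rewrite ?orbT.
have eqU : perm_eq (Zs ++ unpair ((u, v) :: ps))
                   ([:: z; u; v] ++ [:: z0, z1 & zs] ++ unpair ps).
  by apply/permP=> p; rewrite /Zs /= !count_cat /=; lia.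
move: Uzs; rewrite (perm_uniq eqU) cat_uniq => /and3P[Unew /hasPn new Uold].
have [|//||Q1 [Q2 [t1 t2 UQ SQ sQ]]] := IH ps.
- by move=> x u' v' /sub0 xz uv; apply: dom => //; rewrite inE uv orbT.
- by case: sz.
have merge w X Y Q : w \in [:: u; v] -> thread r Zs X -> thread r Zs Y ->
    thread r Zs Q -> perm_eq (X ++ Y ++ Q) (z :: Q1 ++ Q2) ->
    r (head z X) w -> r (head z Y) w ->
    exists Q1 Q2, [/\ thread r Zs Q1, thread r Zs Q2, uniq (Q1 ++ Q2),
      {subset Q1 ++ Q2 <= Zs ++ unpair ((u, v) :: ps)} &
      size (Q1 ++ Q2) = (size zs).*2.+4].
  case: X Y => [|a q] [|b q'] // w_uv tX tY tQ eqQ aw bw.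
  have eqQ' : perm_eq ((rev (a :: q) ++ w :: b :: q') ++ Q) (z :: w :: Q1 ++ Q2).
    apply: perm_trans (perm_merge _ _ _ _) _; apply: (@perm_trans _ [:: w, z & Q1 ++ Q2]).
      by rewrite perm_cons.
    by apply/permP=> p /=; rewrite addnCA.
  exists (rev (a :: q) ++ w :: b :: q'), Q; split=> //.
  - exact: thread_join.
  - rewrite (perm_uniq eqQ') /= UQ andbT inE negb_or; move: Unew => /=.
    rewrite !inE !negb_or -andbA => /and3P[zu zv _].
    have notQ x : x \in [:: z; u; v] -> x \notin Q1 ++ Q2.
      by move=> x_new; apply: contraL x_new => /SQ/new.
    rewrite !notQ ?mem_head //; last by rewrite inE w_uv orbT.
    by move: w_uv; rewrite !inE => /orP[] /eqP->; rewrite ?zu ?zv.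
  - move=> x; rewrite (perm_mem eqQ') 2!in_cons (perm_mem eqU).
    case/or3P=> [/eqP->|/eqP->|/SQ xQ].
    + by rewrite mem_cat mem_head.
    + by rewrite mem_cat inE w_uv orbT.
    + by rewrite mem_cat xQ orbT.
  - by rewrite (perm_size eqQ') /= sQ.
have t1' := thread_sub sub0 t1; have t2' := thread_sub sub0 t2.
have z_Zs : z \in Zs by rewrite !inE eqxx !orbT.
have t3 : thread r Zs [:: z] by rewrite /= z_Zs.
have h_dom Q : thread r Zs Q -> r (head z Q) u || r (head z Q) v.
  by case: Q => // a q /and3P[_ a_Z _]; apply: dom; rewrite ?mem_head.
have P3 : perm_eq (Q1 ++ Q2 ++ [:: z]) (z :: Q1 ++ Q2).
  by rewrite catA cats1 perm_rcons.
have P2 : perm_eq (Q1 ++ [:: z] ++ Q2) (z :: Q1 ++ Q2).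
  by rewrite perm_catCA.
have P1 : perm_eq (Q2 ++ [:: z] ++ Q1) (z :: Q1 ++ Q2).
  by rewrite perm_catCA /= perm_cons perm_catC.
have u_uv : u \in [:: u; v] by rewrite mem_head.
have v_uv : v \in [:: u; v] by rewrite !inE eqxx orbT.
case/orP: (h_dom _ t1') => r1; case/orP: (h_dom _ t2') => r2;
  case/orP: (h_dom _ t3) => r3;
  by [apply: merge P3 r1 r2 | apply: merge P2 r1 r3 | apply: merge P1 r2 r3].
Qed.

Lemma take_pairs (T : Type) (s : seq T) i : take i (pairs s) = pairs (take i.*2 s).
Proof.
elim/pair_ind: s i => [|x|x y s IH] [|i] //; rewrite doubleS //=.
by rewrite IH.
Qed.

Lemma unpair_cat (T : Type) (ps qs : seq (T * T)) :
  unpair (ps ++ qs) = unpair ps ++ unpair qs.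
Proof. by elim: ps => //= -[x y] ps ->. Qed.

(** Let [h = m./2] and let [P] run from [p1] to [pl]. If [P] cannot be extended,
    then no vertex [z] outside is adjacent to [p1], to [pl], or to two consecutive
    vertices of [P]. For [h >= 2], [h] vertices outside and [h - 2] pairs taken from
    the interior of [P] yield two threads of the complement; [p1] joins them and
    [pl] prolongs one end, which makes [2 * h] vertices. If [m] is odd, then a
    further pair supplies one more vertex at the other end. *)
Lemma path_or_copath (T : finType) (e : rel T) (A : {set T}) n m P :
  symmetric e -> 2 <= m <= n -> n.-1 + m./2 <= #|A| ->
  uniq P -> sorted e P -> {subset P <= A} -> size P = n.-1 ->
  has_path e A n \/ has_path (fun x y => ~~ e x y) A m.
Proof.
move=> e_sym /andP[m_ge2 le_mn] cardA UP pP PA sP.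
pose ne x y := ~~ e x y.
have ne_sym : symmetric ne by move=> x y; rewrite /ne e_sym.
have [[s1 [s2 [z [defP zA zP p12]]]]|noins] :
    (exists s1 s2 z, [/\ P = s1 ++ s2, z \in A, z \notin P & sorted e (s1 ++ z :: s2)])
    \/ (forall s1 s2 z, P = s1 ++ s2 -> z \in A -> z \notin P ->
          ~~ sorted e (s1 ++ z :: s2)).
- have [/existsP[z /and3P[zA zP /hasP[i _ Hi]]]|/existsPn none] :=
    boolP [exists z, [&& z \in A, z \notin P &
             has (fun i => sorted e (take i P ++ z :: drop i P)) (iota 0 n.+1)]].
    by left; exists (take i P), (drop i P), z; rewrite cat_take_drop.
  right=> s1 s2 z defP zA zP; have:= none z; rewrite zA zP => /hasPn none_i.
  have := none_i (size s1); rewrite defP take_size_cat // drop_size_cat //; apply.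
  by rewrite mem_iota /=; move: sP; rewrite defP size_cat; case: (size s1) => *; lia.
- left; exists (s1 ++ z :: s2); split=> //.
  + by rewrite -cat1s uniq_catCA cat1s /= -defP zP.
  + move=> x; rewrite mem_cat inE orbCA => /orP[/eqP->//|].
    by rewrite -mem_cat -defP => /PA.
  + by rewrite size_cat /= addnS -size_cat -defP sP; lia.
(* Now no vertex of A outside P can be inserted anywhere into P. *)
right; rewrite -/ne.
pose h := m./2.
pose zs := take h (enum (A :\: [set x in P])).
have szs : size zs = h.
  rewrite size_takel // -cardE cardsD.
  have -> : A :&: [set x in P] = [set x in P].
    by apply/setIidPr/subsetP=> x; rewrite inE => /PA.
  by rewrite cardsE (card_uniqP UP) sP /h; lia.
have Uzs : uniq zs by rewrite take_uniq ?enum_uniq.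
have zsP z : z \in zs -> (z \in A) && (z \notin P).
  by move/mem_take; rewrite mem_enum !inE andbC.
case defP: P => [|p1 P1]; first by move: sP; rewrite defP /=; lia.
have ne1 z : z \in zs -> ne z p1.
  case/zsP/andP=> zA zP; have:= noins [::] P z erefl zA zP.
  by move: pP; rewrite defP /= => ->; rewrite andbT.
have nel z : z \in zs -> ne z (last p1 P1).
  case/zsP/andP=> zA zP; have := noins P [::] z (esym (cats0 P)) zA zP.
  by move: pP; rewrite defP /= cat_path /= => ->; rewrite andbT /ne e_sym.
have sub_ne r : {subset r <= zs ++ P} -> {subset r <= A}.
  by move=> sr x /sr; rewrite mem_cat => /orP[/zsP/andP[]|/PA].
have [h1|h2] : h = 1 \/ 2 <= h by rewrite /h; lia.
  case: zs szs {Uzs} zsP ne1 nel sub_ne; rewrite h1 // => z [|//] _ zsP ne1 nel sub_ne.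
  have zz := mem_head z [::]; have /andP[_ zP] := zsP z zz.
  have [m2|m3] : m = 2 \/ m = 3 by move: h1; rewrite /h; lia.
    exists [:: z; p1]; rewrite m2 /= ne1 // andbT inE; split=> //.
      by apply: contraNneq zP => ->; rewrite defP mem_head.
    by apply: sub_ne => x; rewrite !inE => /orP[] /eqP->; rewrite defP !inE eqxx ?orbT.
  case/lastP: P1 defP nel => [|M pl] defP; first by move: sP; rewrite defP m3 /=; lia.
  rewrite last_rcons => nel; exists [:: p1; z; pl]; rewrite m3 /= ne_sym ne1 // nel //.
  have: uniq (z :: P) by rewrite /= zP.
  rewrite defP /= rcons_uniq inE !mem_rcons !inE !negb_or -!andbA.
  move=> /and5P[zp1 zpl _ p1pl _]; rewrite [p1 == z]eq_sym zp1 zpl p1pl; split=> //.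
  apply: sub_ne => x; rewrite defP !inE mem_rcons inE.
  by case/or3P=> /eqP->; rewrite eqxx ?orbT.
case: zs szs Uzs zsP ne1 nel sub_ne => [|z0 [|z1 zs]];
  [by move=> szs; move: h2; rewrite -szs..|].
set Zs := [:: z0, z1 & zs] => szs UZs zsP ne1 nel sub_ne.
case/lastP: P1 defP nel => [|M pl] defP; first by move: sP h2; rewrite defP /h /=; lia.
rewrite last_rcons => nel.
have sM : size M = n - 3 by move: sP; rewrite defP /= size_rcons; lia.
have domP z u v : z \in Zs -> (u, v) \in pairs M -> ne z u || ne z v.
  move=> /zsP/andP[zA zP] /mem_pairs[s1 [s2 defM]].
  rewrite /ne -negb_and; apply/negP=> /andP[ezu ezv].
  have := noins (p1 :: s1 ++ [:: u]) (v :: rcons s2 pl) z.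
  rewrite {1}defP defM -!cats1 /= -!catA /= => /(_ erefl zA zP)/negP; apply.
  move: pP; rewrite defP defM /= rcons_cat /= !cat_path /= !rcons_path /=.
  by rewrite cats1 rcons_path (e_sym u z) ezu ezv => /and5P[-> -> _ -> ->].
pose ps := take (h - 2) (pairs M).
have sps : size ps = size zs.
  rewrite size_takel ?size_pairs ?sM; first by move: szs => /= <-; lia.
  by rewrite /h; lia.
have UZP : uniq (Zs ++ P).
  rewrite cat_uniq UZs UP andbT; apply/hasPn=> x xP; apply/negP=> /zsP/andP[_].
  by rewrite xP.
have sub_ps : subseq (unpair ps) M.
  rewrite /ps take_pairs; apply: subseq_trans (unpair_subseq _) _; exact: take_subseq.
have [|||Q1 [Q2 [t1 t2 UQ SQ sQ]]] := @two_threads T ne zs ps z0 z1 ne_sym.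
- by move=> z u v zZ /mem_take; apply: domP.
- have sub_psP : subseq (unpair ps) P.
    apply: subseq_trans sub_ps _; rewrite defP -cats1 -(cat1s p1).
    exact: subseq_trans (prefix_subseq M [:: pl]) (suffix_subseq _ _).
  exact: subseq_uniq (cat_subseq (subseq_refl Zs) sub_psP) UZP.
- by [].
case: Q1 Q2 t1 t2 UQ SQ sQ => [|a q] [|b q'] // t1 t2 UQ SQ sQ.
have [/and3P[_ a_Z _] /and3P[_ b_Z _]] := (t1, t2).
have a_p1 : ne a p1 by exact: ne1.
have b_p1 : ne b p1 by exact: ne1.
have := thread_join ne_sym t1 t2 a_p1 b_p1.
set R := rev _ ++ _ => tR.
have eqR : perm_eq (rcons R pl) [:: p1, pl & (a :: q) ++ b :: q'].
  rewrite -cats1; apply: perm_trans (perm_merge _ _ _ _) _.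
  by rewrite perm_cons catA cats1 perm_rcons.
have: uniq ([:: p1; pl] ++ Zs ++ M).
  move: UZP; rewrite defP; congr is_true; apply: perm_uniq.
  by rewrite perm_sym perm_catCA perm_cat2l /= perm_cons perm_sym perm_rcons.
rewrite cat_uniq => /and3P[Upp /hasPn new UZM].
have sQM : {subset (a :: q) ++ b :: q' <= Zs ++ M}.
  move=> x /SQ; rewrite !mem_cat => /orP[->//|x_ps].
  by rewrite (mem_subseq sub_ps x_ps) orbT.
have UR : uniq (rcons R pl).
  rewrite (perm_uniq eqR) -[[:: p1, pl & _]]/([:: p1; pl] ++ _) cat_uniq Upp UQ andbT.
  by apply/hasPn=> x /sQM/new.
have sR : size (rcons R pl) = h.*2.
  rewrite (perm_size eqR) -szs.
  by rewrite -[size [:: p1, pl & _]]/((size ((a :: q) ++ b :: q')).+2) sQ.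
have RA : {subset rcons R pl <= A}.
  have MP : {subset [:: p1, pl & M] <= P}.
    by move=> y; rewrite defP !inE mem_rcons inE.
  apply: sub_ne => x; rewrite (perm_mem eqR) 2!in_cons (mem_cat x Zs P).
  case/or3P=> [/eqP->|/eqP->|/sQM].
  - by rewrite (MP p1) ?orbT ?mem_head.
  - by rewrite (MP pl) ?orbT // !inE eqxx orbT.
  - rewrite (mem_cat x Zs M) => /orP[->//|xM].
    by rewrite (MP x) ?orbT // !inE xM !orbT.
case defR: R tR => [|x0 R'] //= /and3P[pR x0Z lRZ].
have pRl : path ne x0 (rcons R' pl) by rewrite rcons_path pR nel.
have := odd_double_half m; rewrite -/h; case: (odd m) => [m_odd|m_even]; last first.
  by exists (rcons R pl); rewrite sR -m_even defR; split; rewrite // -defR.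
have lt_h : h - 2 < size (pairs M).
  by rewrite size_pairs sM; move: m_odd le_mn h2; clear; lia.
have [[u v] def_uv] : exists p, drop (h - 2) (pairs M) = p :: drop (h - 2).+1 (pairs M).
  by exists (nth (p1, p1) (pairs M) (h - 2)); apply: drop_nth.
have uvM : (u, v) \in pairs M.
  by apply: (@mem_drop (h - 2)); rewrite def_uv mem_head.
have subMM : subseq (unpair ps ++ [:: u; v]) M.
  apply: subseq_trans (unpair_subseq M).
  rewrite -(cat_take_drop (h - 2) (pairs M)) unpair_cat def_uv /= -/ps.
  by apply: cat_subseq => //=; rewrite !eqxx sub0seq.
have Uuv : uniq (Zs ++ unpair ps ++ [:: u; v]).
  by apply: subseq_uniq UZM; apply: cat_subseq.
have [w w_uv x0w] : exists2 w, w \in [:: u; v] & ne x0 w.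
  by case/orP: (domP _ _ _ x0Z uvM) => H; [exists u | exists v]; rewrite ?inE ?eqxx ?orbT.
have wM : w \in M by apply: (mem_subseq subMM); rewrite mem_cat w_uv orbT.
exists (w :: rcons R pl); split.
- have /new w_new : w \in Zs ++ M by rewrite (mem_cat w Zs M) wM orbT.
  move: Uuv; rewrite catA cat_uniq => /and3P[_ /hasPn/(_ w w_uv) wN _].
  rewrite cons_uniq UR andbT (perm_mem eqR) -[[:: p1, pl & _]]/([:: p1; pl] ++ _).
  by rewrite mem_cat (negPf w_new); apply: contra wN => /SQ.
- by rewrite defR /= ne_sym x0w.
- move=> x; rewrite inE => /orP[/eqP->|/RA//].
  by apply: PA; rewrite defP inE mem_rcons inE wM !orbT.
- by rewrite -m_odd /= sR.
Qed.

(** By [path_or_copath] a path with [n.-1] vertices suffices, and the induction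
    supplies one. For [m = n] it is applied to the complement, with [n] and [n.-1], so
    that the shorter of the two paths is the one in the graph. *)
Lemma gerencser_gyarfas (T : finType) (e : rel T) (A : {set T}) n m :
  symmetric e -> 2 <= n -> m <= n -> n.-1 + m./2 <= #|A| ->
  has_path e A n \/ has_path (fun x y => ~~ e x y) A m.
Proof.
move=> e_sym; have [N] := ubnP (n + m); elim: N e e_sym n m => // N IH e e_sym n m.
move=> lt_N n2 le_mn cardA; have [m1|m2] := leqP m 1.
  right; have sT : size (take m (enum A)) = m by rewrite size_takel // -cardE; lia.
  exists (take m (enum A)); rewrite take_uniq ?enum_uniq; split=> //.
    by case: take sT m1 => [|x [|y s]] //= <-.
  by move=> x /mem_take; rewrite mem_enum.
have step P : uniq P -> sorted e P -> {subset P <= A} -> size P = n.-1 ->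
    has_path e A n \/ has_path (fun x y => ~~ e x y) A m.
  by apply: path_or_copath => //; rewrite m2.
have [lt_mn|ge_mn] := ltnP m n.
  have [[P [UP pP PA sP]]|] : has_path e A n.-1 \/ has_path (fun x y => ~~ e x y) A m.
  - by apply: IH => //; lia.
  - exact: (step P).
  - by right.
have eq_mn : m = n by lia.
have ne_sym : symmetric (fun x y => ~~ e x y) by move=> x y; rewrite e_sym.
have [|[P [UP pP PA sP]]] : has_path (fun x y => ~~ e x y) A n \/
    has_path (fun x y => ~~ ~~ e x y) A n.-1.
- by apply: IH => //; lia.
- by right; rewrite eq_mn.
apply: (step P) => //; rewrite (eq_sorted (e' := fun x y => ~~ ~~ e x y)) //.
by move=> x y; rewrite negbK.
Qed.

(** * Sets without edges between them, and depth-first search *)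

Section Search.
Variables (T : finType) (e : rel T).

Definition separated (A B : {set T}) : bool :=
  [forall x in A, forall y in B, ~~ e x y].

(** Connectedness of the graph induced on [A], in terms of cuts. *)
Definition connected (A : {set T}) : bool :=
  [forall B : {set T}, [&& B \subset A, B != set0 & separated B (A :\: B)] ==> (B == A)].

Lemma separatedP (A B : {set T}) :
  reflect (forall x y, x \in A -> y \in B -> ~~ e x y) (separated A B).
Proof.
apply: (iffP forall_inP) => [sAB x y xA yB|sAB x xA].
  by move/forall_inP: (sAB x xA) => /(_ y yB).
by apply/forall_inP=> y yB; exact: sAB.
Qed.

Lemma separatedS (A B A' B' : {set T}) :
  A' \subset A -> B' \subset B -> separated A B -> separated A' B'.
Proof.
move=> /subsetP sA /subsetP sB /separatedP sAB.
by apply/separatedP=> x y /sA xA /sB yB; apply: sAB.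
Qed.

Definition apart (A B : {set T}) : bool := [disjoint A & B] && separated A B.

Hypothesis e_sym : symmetric e.

Lemma separatedC (A B : {set T}) : separated A B -> separated B A.
Proof. by move/separatedP=> sAB; apply/separatedP=> x y xB yA; rewrite e_sym sAB. Qed.

Lemma connectedP (A B : {set T}) :
  connected A -> B \subset A -> B != set0 -> B != A ->
  exists x y, [/\ x \in B, y \in A, y \notin B & e x y].
Proof.
move=> /forallP/(_ B) + sBA nB0 nBA; rewrite sBA nB0 (negPf nBA) implybF /=.
case/forall_inPn=> x xB /forall_inPn[y]; rewrite inE negbK => /andP[yB yA] exy.
by exists x, y.
Qed.

(** A moment of a depth-first search of [A]: [P] is the stack, top first, and [U] the
    set of unvisited vertices. Vertices that have left the stack have no
    neighbour in [U]. *)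
Definition dfs_state (A : {set T}) (P : seq T) (U : {set T}) : Prop :=
  [/\ uniq P, sorted e P, {subset P <= A :\: U}, U \proper A &
      separated (A :\: (U :|: [set x in P])) U].

Lemma dfs_push A P U p x :
  dfs_state A (p :: P) U -> x \in U -> e p x -> dfs_state A [:: x, p & P] (U :\ x).
Proof.
move=> [UP pP sP pU sU] xU epx; split.
- rewrite cons_uniq UP andbT; apply/negP=> /sP.
  by rewrite inE xU.
- by rewrite /= e_sym epx.
- have xA : x \in A := subsetP (proper_sub pU) x xU.
  move=> y; rewrite inE => /orP[/eqP->|/sP]; first by rewrite !inE eqxx.
  by rewrite !inE => /andP[/negPf-> ->]; rewrite andbF.
- exact: sub_proper_trans (subsetDl _ _) pU.
- apply: separatedS sU; last exact: subsetDl.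
  apply/subsetP=> y; rewrite !inE !negb_or negb_and negbK.
  by case: (y == x) => //=; rewrite !andbF.
Qed.

Lemma dfs_pop A P U p :
  dfs_state A (p :: P) U -> (forall x, x \in U -> ~~ e p x) -> dfs_state A P U.
Proof.
move=> [UP pP sP pU /separatedP sU] none; split=> //.
- by case/andP: UP.
- exact: path_sorted pP.
- by move=> y yP; apply: sP; rewrite inE yP orbT.
apply/separatedP=> y z; rewrite !inE negb_or -andbA => /and3P[yU yP yA] zU.
have [->|np] := eqVneq y p; first exact: none.
by apply: sU => //; rewrite !inE (negPf np) negb_or yU yP.
Qed.

Lemma dfs_done A U : connected A -> dfs_state A [::] U -> U = set0.
Proof.
move=> cA [_ _ _ pU sU]; apply/eqP; apply: contraT => nU0.
have nUA : U != A by move: (pU); rewrite properEneq => /andP[].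
have [x [y [xU yA yU exy]]] := connectedP cA (proper_sub pU) nU0 nUA.
move/separatedP: sU => /(_ y x); rewrite !inE e_sym exy orbF yU yA => sU.
by have := sU isT xU.
Qed.

(** The search is continued until exactly [d] of the vertices of [U] have been
    visited and have left the stack again; they form [R]. Vertices are popped one
    at a time, so any size can be hit, and the cost is the part [Q] of the new stack
    that lies in [U]. Meanwhile [a] vertices of the old stack are popped. *)
Lemma dfs_phase A P U d :
  connected A -> dfs_state A P U -> d <= #|U| ->
  exists a Q (R U' : {set T}), [/\ dfs_state A (Q ++ drop a P) U', a <= size P,
    (Q != [::] -> a < size P),
    [/\ apart R U', R \subset U, U' \subset U & {subset Q <= U}] &
    #|R| = d /\ #|U| = size Q + d + #|U'|].
Proof.
move=> cA; rewrite -{1}(drop0 P) -{1}[drop 0 P]cat0s.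
suff gen m : forall a Q (R U' : {set T}), 2 * #|U'| + size (Q ++ drop a P) < m ->
    dfs_state A (Q ++ drop a P) U' -> a <= size P -> (Q != [::] -> a < size P) ->
    [/\ separated R U', R \subset U & U' \subset U] ->
    {subset Q <= U :\: R} -> [disjoint R & U'] -> #|R| <= d -> d <= #|U| ->
    #|U| = size Q + #|R| + #|U'| ->
    exists a Q (R U' : {set T}), [/\ dfs_state A (Q ++ drop a P) U', a <= size P,
    (Q != [::] -> a < size P),
    [/\ apart R U', R \subset U, U' \subset U & {subset Q <= U}] &
    #|R| = d /\ #|U| = size Q + d + #|U'|].
  move=> st le_d; apply: (gen _ 0 [::] set0 U (ltnSn _)) => //=.
  - by split=> //; [apply/separatedP=> x y; rewrite inE | exact: sub0set].
  - by rewrite -setI_eq0 set0I.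
  - by rewrite cards0.
  - by rewrite cards0.
(* A push removes a vertex from U' and a pop one from the stack, hence the
   weight 2 of U'. *)
elim: m => // m IH a Q R U' lt_m st le_a lt_a [sRU RU U'U] QU dRU leR le_d cU.
have [eqd|neqd] := eqVneq #|R| d.
  exists a, Q, R, U'; rewrite -eqd; split=> //; rewrite /apart dRU sRU.
  by split=> // x /QU/setDP[].
have ltR : #|R| < d by rewrite ltn_neqAle neqd.
case defQ: (Q ++ drop a P) (st) lt_m => [|p S] stS lt_m.
  have U'0 := dfs_done cA stS.
  case: Q defQ {QU st lt_a} cU => // _; rewrite U'0 cards0 add0n addn0 => cU.
  by move: le_d; rewrite cU leqNgt ltR.
have [/existsP[x /andP[xU epx]]|/existsPn none] := boolP [exists x, (x \in U') && e p x].
  have xR : x \notin R by rewrite (disjointFl dRU).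
  apply: (IH a (x :: Q) R (U' :\ x)) => //.
  - by move: lt_m; rewrite (cardsD1 x U') xU cat_cons defQ /=; clear; lia.
  - by rewrite cat_cons defQ; apply: dfs_push.
  - move=> _; rewrite ltn_neqAle le_a andbT.
    case: Q {IH lt_m st QU cU} defQ lt_a => [|? ?] /= defQ lt_a.
      by apply/eqP=> eqa; move: defQ; rewrite eqa drop_size.
    by apply: contraTneq (lt_a isT) => ->; rewrite ltnn.
  - split=> //; first by apply: separatedS sRU => //; exact: subsetDl.
    by apply: subset_trans U'U; exact: subsetDl.
  - move=> y; rewrite inE => /orP[/eqP->|/QU//].
    by rewrite inE xR (subsetP U'U).
  - by apply: disjointWr dRU; exact: subsetDl.
  - by rewrite cU (cardsD1 x U') xU /= add1n addnS !addSn.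
have npU x : x \in U' -> ~~ e p x by move=> xU; have := none x; rewrite xU.
have {}stS := dfs_pop stS npU.
case: Q st lt_a QU cU defQ => [|p' Q] st lt_a QU cU /= defQ.
  have lt_aP : a < size P.
    by rewrite ltnNge; apply/negP=> /drop_oversize E; rewrite E in defQ.
  have defS : S = drop a.+1 P by rewrite -add1n -drop_drop defQ /= drop0.
  apply: (IH a.+1 [::] R U') => //; last by rewrite /= -defS.
  by move: lt_m; rewrite /= -defS addnS.
case: defQ => [eqp defS]; rewrite eqp in QU; rewrite -defS in stS.
have /setDP[pU pNR] := QU p (mem_head _ _).
have pNU' : p \notin U'.
  by move: st => [_ _ sP _ _]; have := sP p; rewrite eqp mem_head !inE => /(_ isT)/andP[].
have pNQ : p \notin Q.
  move: st => [+ _ _ _ _]; rewrite eqp /= mem_cat negb_or.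
  by case/andP=> /andP[].
apply: (IH a Q (p |: R) U') => //.
- by move: lt_m; rewrite -defS /= addnS.
- by move=> _; apply: lt_a.
- split=> //.
    apply/separatedP=> x y; rewrite !inE => /orP[/eqP->|xR] yU; first exact: npU.
    by move/separatedP: sRU; apply.
  by rewrite subUset sub1set pU.
- move=> y yQ; have := QU y; rewrite inE yQ orbT => /(_ isT).
  rewrite !inE negb_or => /andP[-> ->]; rewrite !andbT.
  by apply: contraNneq pNQ => <-.
- by rewrite disjoints_subset subUset sub1set inE pNU' -disjoints_subset.
- by rewrite cardsU1 pNR.
- by rewrite cU cardsU1 pNR /= addnA addn1 addSn.
Qed.

(** The complement of the graph contains a complete multipartite graph in [A], with
    parts of sizes [D]. *)
Definition has_multipartite (A : {set T}) (D : seq nat) : Prop :=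
  exists Ss : seq {set T}, [/\ [seq #|(B : {set T})| | B <- Ss] = D,
    all (fun B : {set T} => B \subset A) Ss & pairwise apart Ss].

Lemma subset_of_card (A : {set T}) d :
  d <= #|A| -> exists2 B : {set T}, B \subset A & #|B| = d.
Proof.
rewrite cardE => le_d; exists [set x in take d (enum A)].
  by apply/subsetP=> x; rewrite inE => /mem_take; rewrite mem_enum.
by rewrite cardsE (card_uniqP _) ?take_uniq ?enum_uniq // size_takel.
Qed.

Lemma apartS (A B A' B' : {set T}) :
  A' \subset A -> B' \subset B -> apart A B -> apart A' B'.
Proof.
move=> sA sB /andP[dAB sAB]; apply/andP; split; last exact: separatedS sAB.
exact: disjointWl sA (disjointWr sB dAB).
Qed.

Lemma has_multipartite_cons (A R B : {set T}) D :
  R \subset A -> B \subset A -> apart R B -> has_multipartite B D ->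
  has_multipartite A (#|R| :: D).
Proof.
move=> RA BA aRB [Ss [<- sSs pSs]]; exists (R :: Ss); rewrite /= RA pSs andbT.
split=> //; apply: sub_all sSs => C CB; first exact: subset_trans CB BA.
exact: apartS aRB.
Qed.

Lemma has_multipartite1 (A : {set T}) s : s <= #|A| -> has_multipartite A [:: s].
Proof. by case/subset_of_card=> B BA cB; exists [:: B]; rewrite /= cB BA. Qed.

Variable n : nat.
Hypothesis no_path : forall p, uniq p -> sorted e p -> size p < n.

Lemma dfs_size A P U : dfs_state A P U -> size P < n.
Proof. by case=> UP pP _ _ _; apply: no_path. Qed.

Lemma dfs_cut A P U D s :
  connected A -> dfs_state A P U -> n.-1 * size D + sumn D + s <= #|U| ->
  has_multipartite U (rcons D s).
Proof.
move=> cA; elim: D P U => [|d D IH] P U st /= leU.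
  by apply: has_multipartite1; move: leU; rewrite muln0.
have [|a [Q [R [U' [st' _ _ [aRU RU U'U _] [cR cU]]]]]] := dfs_phase cA st (d := d).
  by apply: leq_trans leU; rewrite -!addnA addnCA leq_addr.
have := dfs_size st'; rewrite size_cat => ltQ.
rewrite -cR; apply: has_multipartite_cons aRU _ => //; apply: IH st' _.
by move: leU ltQ; rewrite cU mulnS; clear; lia.
Qed.

(** The popped part of the old stack, the vertex at which the search turned, and the
    new part [Q] form a path. *)
Lemma dfs_bend A P U a Q U' :
  dfs_state A P U -> dfs_state A (Q ++ drop a P) U' -> {subset Q <= U} ->
  (Q != [::] -> a < size P) -> Q = [::] \/ size Q + a.+1 < n.
Proof.
move=> [UP pP sP _ _] [UQ pQ _ _ _] QU lt_a.
have [->|nQ] := eqVneq Q [::]; [by left | right].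
have {}lt_a := lt_a nQ; case: Q nQ UQ pQ QU => // x Q _ UQ pQ QU.
case defP: (drop a P) UQ pQ => [|v P'] UQ pQ.
  by have := size_drop a P; rewrite defP /=; move: lt_a; clear; lia.
have defP2 : P = take a P ++ v :: P' by rewrite -defP cat_take_drop.
have sz : size (take a P) = a by rewrite size_take lt_a.
suff: size ((x :: Q) ++ v :: rev (take a P)) < n by rewrite size_cat /= size_rev sz.
apply: no_path.
- move: UQ; rewrite !cat_uniq => /and3P[-> /= + /andP[_ _]].
  rewrite !negb_or => /andP[-> _] /=.
  have: uniq (take a P ++ v :: P') by rewrite -defP2.
  rewrite -cat_rcons cat_uniq rcons_uniq rev_uniq mem_rev.
  case/andP=> /andP[-> ->] _; rewrite !andbT.
  apply/hasPn=> y; rewrite mem_rev => /mem_take /sP yP.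
  by apply: contraTN yP => /QU; rewrite !inE => ->.
move: pQ; rewrite /= !cat_path /= => /and3P[-> -> _] /=.
have: sorted e (rcons (take a P) v).
  by move: pP; rewrite {1}defP2 -cat_rcons => /cat_sorted2[].
rewrite -rev_sorted rev_rcons /= (eq_path (e' := e)) // => y z; exact: e_sym.
Qed.

(** By [dfs_bend] and because stacks are paths, the first three phases together
    waste at most [2 * n.-1 - 1] vertices, and every later phase wastes at most
    [n.-1]. Without the saving of one path the last part could not be as large
    as needed. *)
Lemma connected_multipartite A d1 d2 d3 D s :
  1 < n -> connected A -> d1 + (d2 + (d3 + sumn D)) <= n ->
  n.-1 * (3 + size D) + s <= #|A| ->
  has_multipartite A [:: d1, d2, d3 & rcons D s].
Proof.
move=> n_gt1 cA leD leA.
have /card_gt0P[r rA] : 0 < #|A|.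
  by apply: leq_trans leA; case: n n_gt1 => [|[|m]].
have st0 : dfs_state A [:: r] (A :\ r).
  split=> //; first by move=> x; rewrite inE => /eqP->; rewrite !inE eqxx rA.
    by rewrite properD1.
  apply/separatedP=> x y; rewrite !inE; case: (x == r); rewrite ?orbT //=.
  by case: (x \in A).
have cU0 : #|A| = 1 + #|A :\ r| by rewrite (cardsD1 r A) rA.
have [|a1 [Q1 [R1 [U1 [st1 le_a1 lt_a1 [aRU1 RU1 UU1 QU1] [cR1 cU1]]]]]] :=
    dfs_phase cA st0 (d := d1).
  move: leA leD n_gt1; rewrite cU0 mulnDr; clear; lia.
have b1 := dfs_bend st0 st1 QU1 lt_a1.
have ltQ1 := dfs_size st1; rewrite size_cat in ltQ1.
have [|a2 [Q2 [R2 [U2 [st2 le_a2 lt_a2 [aRU2 RU2 UU2 QU2] [cR2 cU2]]]]]] :=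
    dfs_phase cA st1 (d := d2).
  have {b1} : size Q1 <= n - 2 by case: b1 => [->//|]; clear; lia.
  by move: leA leD n_gt1; rewrite cU0 cU1 mulnDr; clear; lia.
have b2 := dfs_bend st1 st2 QU2 lt_a2.
have ltQ2 := dfs_size st2; rewrite size_cat in ltQ2.
have [|a3 [Q3 [R3 [U3 [st3 le_a3 lt_a3 [aRU3 RU3 UU3 QU3] [cR3 cU3]]]]]] :=
    dfs_phase cA st2 (d := d3).
  have {b1} : size Q1 <= n - 2 by case: b1 => [->//|]; clear; lia.
  have {b2} : size Q2 <= n - 2 by case: b2 => [->//|]; clear; lia.
  by move: leA leD n_gt1; rewrite cU0 cU1 cU2 mulnDr; clear; lia.
have b3 := dfs_bend st2 st3 QU3 lt_a3.
have ltQ3 := dfs_size st3; rewrite size_cat in ltQ3.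
(* The root of the search counts as waste of the first phase. *)
have waste : 1 + size Q1 + size Q2 + size Q3 <= n.-1 + n.-2.
  have nil0 (Q : seq T) : Q = [::] -> size Q = 0 by move->.
  move: le_a1 le_a2 le_a3 ltQ1 ltQ2 ltQ3 n_gt1; rewrite !(size_drop, size_cat) /=.
  have {b1} : size Q1 = 0 \/ size Q1 + a1.+1 < n by case: b1 => [/nil0|]; [left | right].
  have {b2} : size Q2 = 0 \/ size Q2 + a2.+1 < n by case: b2 => [/nil0|]; [left | right].
  have {b3} : size Q3 = 0 \/ size Q3 + a3.+1 < n by case: b3 => [/nil0|]; [left | right].
  have {lt_a1} : a1 = 1 -> size Q1 = 0.
    by move=> a1E; move: lt_a1; rewrite a1E; case: (Q1) => //= x Q /(_ isT); rewrite ltnn.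
  move: (size Q1) (size Q2) (size Q3) => q1 q2 q3; clear; lia.
rewrite -cR1; apply: has_multipartite_cons aRU1 _ => //.
  exact: subset_trans RU1 (subsetDl _ _).
  exact: subset_trans UU1 (subsetDl _ _).
rewrite -cR2; apply: has_multipartite_cons aRU2 _ => //.
rewrite -cR3; apply: has_multipartite_cons aRU3 _ => //.
apply: dfs_cut cA st3 _.
move: leA leD n_gt1 waste; rewrite cU0 cU1 cU2 cU3 mulnDr; clear; nia.
Qed.
End Search.

(** * Three parts from an extremal path *)

Section Tripartite.
Variables (T : finType) (e : rel T).
Hypothesis e_sym : symmetric e.
Notation separated := (separated e).
Notation apart := (apart e).

(** The component of [x] in the graph induced on [S], and [[set x]] if [x] is not in
    [S]. *)
Definition comp (S : {set T}) (x : T) : {set T} :=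
  [set y | connect (fun u v => [&& u \in S, v \in S & e u v]) x y].

Lemma comp_refl S x : x \in comp S x.
Proof. by rewrite inE connect0. Qed.

Lemma comp_eq S x y : y \in comp S x -> comp S y = comp S x.
Proof.
rewrite inE => xy; apply/setP=> z; rewrite !inE.
apply/esym/same_connect => //; apply: sym_connect_sym => u v.
by rewrite e_sym andbCA.
Qed.

Lemma comp_step (S : {set T}) x y z :
  y \in comp S x -> y \in S -> z \in S -> e y z -> z \in comp S x.
Proof.
rewrite !inE => xy yS zS eyz; apply: connect_trans xy (connect1 _).
by rewrite yS zS.
Qed.

Lemma comp_min (S B : {set T}) x :
  x \in B -> (forall u v, u \in B -> v \in S -> e u v -> v \in B) ->
  comp S x \subset B.
Proof.
move=> xB stable; apply/subsetP=> y; rewrite inE => /connectP[p].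
elim: p x xB => [|z p IH] x xB /=; first by move=> _ ->.
by case/andP=> /and3P[_ zS exz]; apply: IH; apply: stable exz.
Qed.

Lemma comp_in (S : {set T}) x : x \in S -> comp S x \subset S.
Proof. by move=> xS; apply: comp_min. Qed.

Lemma comp_sub (S S' : {set T}) x : comp S x \subset S' -> comp S x \subset comp S' x.
Proof.
move=> /subsetP sS; apply/subsetP=> y; rewrite !inE => /connectP[p pp ->].
apply/connectP; exists p => //.
apply: (sub_in_path (P := [in comp S x]) _ _ pp).
  by move=> u v /sS uS' /sS vS' /and3P[_ _ euv]; rewrite uS' vS'.
by apply/allP=> u /(path_connect pp); rewrite inE.
Qed.

Variables (n : nat) (A : {set T}) (t : nat).
Hypothesis no_path : forall p, uniq p -> sorted e p -> size p < n.

Definition rest (P : seq T) (C : {set T}) : {set T} := A :\: (C :|: [set x in P]).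

(** [C] is a union of components of the graph induced on [A] without [P]. It need
    not be connected: a vertex taken out of [C] may separate the rest, which
    is still kept together as one set of controlled size. *)
Definition config (P : seq T) (C : {set T}) : Prop :=
  [/\ uniq P, sorted e P, {subset P <= A :\: C}, C \subset A /\ separated C (rest P C) &
      t <= #|C|].

Definition big (P : seq T) (C : {set T}) : {set T} :=
  [set x in rest P C | t < #|comp (rest P C) x|].

(** All vertices of a component with more than [t] vertices count, because it may fall
    into small pieces when it loses a vertex. Of [C] only the surplus over [t]
    counts, because [C] is kept together. *)
Definition excess (P : seq T) (C : {set T}) : nat := #|big P C| + (#|C| - t).

Lemma in_rest P C x : (x \in rest P C) = [&& x \in A, x \notin C & x \notin P].
Proof. by rewrite !inE negb_or andbC. Qed.

(** Entering [C] from the end of a path [Q] that covers [P] pays off, whatever else [Q]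
    covers, since further vertices on the path only make components smaller. *)
Lemma push_config P C Q z :
  config P C -> t < #|C| -> z \in C -> {subset P <= Q} -> {subset Q <= A :\: C} ->
  uniq Q -> sorted e (z :: Q) ->
  config (z :: Q) (C :\ z) /\ excess (z :: Q) (C :\ z) < excess P C.
Proof.
move=> [UP pP PA [CA sC] tC] ltC zC PQ QA UQ pzQ.
have zQ : z \notin Q by apply/negP=> /QA; rewrite inE zC.
have cC : #|C| = 1 + #|C :\ z| by rewrite (cardsD1 z C) zC.
have sub_rest : rest (z :: Q) (C :\ z) \subset rest P C.
  apply/subsetP=> x; rewrite !in_rest !inE !negb_or negb_and negbK.
  case: eqVneq => [->|_] /=; first by rewrite !andbF.
  by case/and3P=> -> -> /=; apply: contra; apply: PQ.
split.
  split.
  - by rewrite /= zQ.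
  - exact: pzQ.
  - move=> x; rewrite inE => /orP[/eqP->|/QA].
      by rewrite !inE eqxx (subsetP CA).
    by rewrite !inE => /andP[/negPf-> ->]; rewrite andbF.
  - split; first exact: subset_trans (subsetDl _ _) CA.
    by apply: separatedS sC => //; exact: subsetDl.
  - by move: ltC; rewrite cC add1n.
rewrite /excess -addSn.
have -> : #|C| - t = (#|C :\ z| - t).+1 by move: ltC; rewrite cC; clear; lia.
rewrite addnS addSn ltnS leq_add2r subset_leq_card //.
apply/subsetP=> x; rewrite inE => /andP[xr lt_t].
rewrite inE (subsetP sub_rest x xr) /=.
apply: leq_trans lt_t (subset_leq_card _); apply: comp_sub.
by apply: subset_trans sub_rest; apply: comp_in.
Qed.

(** Removing an end of [P] that has no neighbour in [C] costs nothing if the component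
    which then arises is small. *)
Lemma pop_config p P C :
  config (p :: P) C -> (forall z, z \in C -> ~~ e p z) ->
  #|comp (p |: rest (p :: P) C) p| <= t ->
  config P C /\ excess P C <= excess (p :: P) C.
Proof.
move=> [UP pP PA [CA sC] tC] pC leK.
have /setDP[pA pNC] := PA p (mem_head _ _).
have eq_rest : rest P C = p |: rest (p :: P) C.
  apply/setP=> x; rewrite in_setU1 !in_rest inE negb_or.
  case: eqVneq => [->|] //=.
  by rewrite pA pNC; case/andP: UP.
split.
  split=> //; [by case/andP: UP | exact: path_sorted pP | | ].
    by move=> x xP; apply: PA; rewrite inE xP orbT.
  split=> //; apply/separatedP=> x y xC; rewrite eq_rest => /setU1P[->|yr].
    by rewrite e_sym pC.
  by move/separatedP: sC; apply.
rewrite leq_add2r subset_leq_card //; apply/subsetP=> x.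
rewrite inE eq_rest => /andP[xr lt_t]; rewrite inE.
have pNx : p \notin comp (p |: rest (p :: P) C) x.
  by apply/negP=> /comp_eq eqK; move: lt_t; rewrite -eqK ltnNge leK.
have sub : comp (p |: rest (p :: P) C) x \subset rest (p :: P) C.
  apply/subsetP=> y yx; have := subsetP (comp_in xr) y yx.
  by case/setU1P=> // eqy; rewrite eqy (negPf pNx) in yx.
rewrite (subsetP sub _ (comp_refl _ _)) /=.
exact: leq_trans lt_t (subset_leq_card (comp_sub sub)).
Qed.

(** The [t] vertices of [C] were not counted as excess and cannot become so, whereas a
    large component that takes the place of [C] is counted with [t] vertices less. *)
Lemma swap_config P C x :
  0 < t -> config P C -> #|C| = t -> x \in big P C ->
  config P (comp (rest P C) x) /\ excess P (comp (rest P C) x) < excess P C.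
Proof.
move=> t_gt0 [UP pP PA [CA sC] tC] eqC; rewrite inE => /andP[xr lt_t].
set K := comp _ _ in lt_t *.
have Kr : K \subset rest P C := comp_in xr.
have KA y : y \in K -> [&& y \in A, y \notin C & y \notin P].
  by move/(subsetP Kr); rewrite in_rest.
have stable u v : u \in K -> v \in rest P C -> e u v -> v \in K.
  by move=> uK vr euv; apply: (comp_step uK (subsetP Kr u uK) vr euv).
have restK y : y \in rest P K -> y \in C \/ y \in rest P C :\: K.
  rewrite (in_setD (rest P C) K y) !in_rest => /and3P[-> -> ->]; rewrite andbT /=.
  by case: (y \in C); [left | right].
split.
  split=> //; last exact: ltnW.
    move=> y yP; have /setDP[yA _] := PA y yP; apply/setDP; split=> //.
    by apply/negP=> /KA; rewrite yP !andbF.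
  split; first by apply/subsetP=> y /KA/and3P[].
  apply/separatedP=> u v uK /restK[vC|/setDP[vr vK]].
    by rewrite e_sym; move/separatedP: sC; apply=> //; apply: (subsetP Kr).
  by apply: contra vK; apply: stable.
have big_sub : big P K \subset big P C :\: K.
  apply/subsetP=> y; rewrite inE => /andP[yr lt_y]; have yr0 := yr.
  case: (restK y yr) => [yC|yrK].
    have sub : comp (rest P K) y \subset C.
      apply: comp_min yC _ => u v uC /restK[//|/setDP[vr _]] euv.
      by move/separatedP: sC => /(_ u v uC vr); rewrite euv.
    by have := subset_leq_card sub; rewrite eqC leqNgt lt_y.
  have sub : comp (rest P K) y \subset rest P C :\: K.
    apply: comp_min yrK _ => u v /setDP[ur uK] /restK[vC|//] euv.
    by move/separatedP: sC => /(_ v u vC ur); rewrite e_sym euv.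
  move: yrK => /setDP[yr' yK]; rewrite in_setD yK inE yr' /=.
  apply: leq_trans lt_y (subset_leq_card (comp_sub _)).
  exact: subset_trans sub (subsetDl _ _).
have Kbig : K \subset big P C.
  apply/subsetP=> y yK; rewrite inE (subsetP Kr) //=.
  by rewrite (comp_eq (yK : y \in comp _ _)).
have := subset_leq_card big_sub; rewrite cardsD (setIidPr Kbig) => le_big.
have := subset_leq_card Kbig; rewrite /excess eqC subnn addn0 => leK.
by move: le_big leK lt_t t_gt0; clear; lia.
Qed.

Definition closed_in (S X : {set T}) : bool := (X \subset S) && separated X (S :\: X).

(** In a minimal union [X] of components with at least [d] vertices, every component [K] is
    indispensable. So either [K] alone has [d] vertices and is all of [X], or both
    [K] and [X :\: K] have fewer than [d]. *)
Lemma greedy_closed (S : {set T}) d m :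
  0 < d <= #|S| -> d <= m.+1 -> (forall x, x \in S -> #|comp S x| <= m) ->
  exists2 X : {set T}, closed_in S X & d <= #|X| <= maxn m (d.-1).*2.
Proof.
move=> /andP[d_gt0 le_dS] le_dm le_m.
pose ok := [pred X : {set T} | closed_in S X && (d <= #|X|)].
have S_ok : ok S.
  rewrite /= /closed_in subxx setDv le_dS andbT.
  by apply/separatedP=> x y; rewrite inE.
case: (@arg_minnP _ S ok (fun X => #|X|) S_ok) => X /andP[clX le_dX] minX.
have [XS /separatedP sX] := andP clX.
exists X; rewrite // le_dX /=.
have /card_gt0P[x xX] : 0 < #|X| by apply: leq_trans le_dX.
have xS := subsetP XS x xX; set K := comp S x.
have KS : K \subset S := comp_in xS.
have stable u v : u \in K -> v \in S -> e u v -> v \in K.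
  by move=> uK vS euv; apply: (comp_step uK (subsetP KS u uK) vS euv).
have KX : K \subset X.
  apply: comp_min xX _ => u v uX vS euv; apply: contraLR euv => vX.
  by apply: sX; rewrite // inE vX.
have clK : closed_in S K.
  rewrite /closed_in KS; apply/separatedP=> u v uK /setDP[vS vK].
  by apply: contra vK; apply: stable.
have leK : #|K| <= m := le_m x xS.
have [le_dK|lt_Kd] := leqP d #|K|.
  by rewrite leq_max (leq_trans _ leK) // minX //= clK.
have clXK : closed_in S (X :\: K).
  rewrite /closed_in (subset_trans (subsetDl _ _) XS) /=.
  apply/separatedP=> u v /setDP[uX uK] /setDP[vS]; rewrite in_setD negb_and negbK.
  case/orP=> [vK|vX]; last by apply: sX; rewrite // inE vX.
  apply: contra uK; rewrite e_sym; apply: stable => //; exact: (subsetP XS).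
have cXK : #|X| = #|K| + #|X :\: K| by rewrite -(cardsID K X) (setIidPr KX).
have K_gt0 : 0 < #|K| by apply/card_gt0P; exists x; apply: comp_refl.
have ltXK : #|X :\: K| < d.
  rewrite ltnNge; apply/negP=> le_d; have := minX (X :\: K).
  by rewrite /= clXK le_d => /(_ isT); rewrite cXK; move: K_gt0; clear; lia.
by rewrite leq_max cXK; move: ltXK lt_Kd; clear; lia.
Qed.

Lemma has_multipartite3 (B1 B2 B3 : {set T}) d1 d2 d3 :
  [/\ B1 \subset A, B2 \subset A & B3 \subset A] ->
  [/\ d1 <= #|B1|, d2 <= #|B2| & d3 <= #|B3|] ->
  [/\ apart B1 B2, apart B1 B3 & apart B2 B3] -> has_multipartite e A [:: d1; d2; d3].
Proof.
move=> [S1 S2 S3] [/subset_of_card[C1 s1 c1] /subset_of_card[C2 s2 c2]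
  /subset_of_card[C3 s3 c3]] [a12 a13 a23].
exists [:: C1; C2; C3]; rewrite /= c1 c2 c3 !andbT; split=> //.
  by rewrite (subset_trans s1) ?(subset_trans s2) ?(subset_trans s3).
by rewrite (apartS s1 s2) ?(apartS s1 s3) ?(apartS s2 s3).
Qed.

Lemma config_contact P C :
  connected e A -> P != [::] -> 0 < t -> config P C ->
  exists w z, [/\ w \in P, z \in C & e w z].
Proof.
move=> cA; case: P => // p P _ t_gt0 [_ _ PA [CA /separatedP sC] tC].
have [||z [w [zC wA wC ezw]]] := connectedP cA CA.
- by rewrite -card_gt0; apply: leq_trans tC.
- apply: contraTneq (PA p (mem_head _ _)) => ->.
  by rewrite inE; case: (p \in A).
exists w, z; rewrite e_sym; split=> //; apply: contraTT ezw => wP.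
by apply: sC => //; rewrite in_rest wA wC.
Qed.

(** A cycle through [P] can be opened at any of its vertices, in particular at a neighbour
    of [C]. *)
Lemma cycle_contact P R C w z :
  config P C -> cycle e (P ++ R) -> uniq (P ++ R) -> {subset R <= rest P C} ->
  w \in P -> z \in C -> e w z ->
  exists Q, [/\ {subset P <= Q}, {subset Q <= A :\: C}, uniq Q & sorted e (z :: Q)].
Proof.
move=> [_ _ PA _ _] cyc UQ Rr wP zC ewz.
have wPR : w \in P ++ R by rewrite mem_cat wP.
have [i Q defQ] := rot_to wPR; exists (w :: Q); rewrite -defQ; split.
- by move=> x xP; rewrite mem_rot mem_cat xP.
- move=> x; rewrite mem_rot mem_cat => /orP[/PA//|/Rr].
  by rewrite in_rest in_setD => /and3P[-> ->].
- by rewrite rot_uniq.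
rewrite defQ /= e_sym ewz /=.
have : cycle e (w :: Q) by rewrite -defQ rot_cycle.
by rewrite /= rcons_path => /andP[].
Qed.

Lemma close_cycle p P C :
  uniq (p :: P) -> sorted e (p :: P) -> p != last p P ->
  last p P \in comp (p |: (last p P |: rest (p :: P) C)) p ->
  exists R, [/\ cycle e ((p :: P) ++ R), uniq ((p :: P) ++ R) &
    {subset R <= rest (p :: P) C}].
Proof.
set q := last p P; set W := p |: _ => UP pP npq qp.
have: p \in comp W q by rewrite (comp_eq qp) comp_refl.
rewrite inE => /connectP[l pl]; case/shortenP: pl => l' pl' Ul' _.
case/lastP: l' pl' Ul' => [|R p'] pl' Ul' lastp.
  by move: npq; rewrite lastp eqxx.
move: lastp; rewrite last_rcons => lastp; rewrite -{p'}lastp in pl' Ul'.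
have RW x : x \in rcons R p -> x \in W.
  elim: (rcons R p) (q) pl' => // y l2 IH z /= /andP[/and3P[_ yW _] pl2].
  by rewrite inE => /orP[/eqP->//|]; apply: IH pl2.
have Rr : {subset R <= rest (p :: P) C}.
  move=> x xR; move: Ul'; rewrite /= rcons_uniq mem_rcons inE negb_or.
  case/andP=> /andP[_ qR] /andP[pR _].
  have /RW : x \in rcons R p by rewrite mem_rcons inE xR orbT.
  case/setU1P=> [eqx|/setU1P[eqx|//]]; first by rewrite eqx (negPf pR) in xR.
  by rewrite eqx (negPf qR) in xR.
exists R; split=> //.
  rewrite /= rcons_cat cat_path -/q; move: pP => /= -> /=.
  by apply: sub_path pl' => x y /and3P[].
rewrite cat_uniq; apply/and3P; split=> //.
  by apply/hasPn=> x /Rr; rewrite in_rest => /and3P[].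
by move: Ul'; rewrite /= rcons_uniq => /and3P[].
Qed.

(** Choose a configuration with least excess and, among these, with the shortest path
    [P], from [p] to [q]. If [#|C| = t], then no component is large (else
    [swap_config]), and [C], a greedy union of components, and what remains are the
    three parts. If [#|C| > t], then neither end of [P] has a neighbour in [C] (else
    [push_config]). Returning [p] to the rest creates a component [Kp] with more
    than [t] vertices (else [pop_config]), and likewise [q] creates [Kq]. If [Kp]
    and [Kq] met or were joined by an edge, then [P] would extend to a cycle outside
    [C], which could be opened at a neighbour of [C]. *)
Lemma connected_tripartite d s :
  connected e A -> 0 < t <= d -> d <= t.+1 -> s <= t.+1 ->
  t.*2 < n -> (d.-1).*2 + t < n -> n.-1 * 2 + s <= #|A| ->
  has_multipartite e A [:: d; t; s].
Proof.
move=> cA /andP[t_gt0 le_td] le_dt le_st le_tn le_dn leA.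
suff gen m : forall P C, config P C -> excess P C * n + size P < m ->
    has_multipartite e A [:: d; t; s].
  apply: (gen _ [::] A _ (ltnSn _)); split=> //.
    by split=> //; apply/separatedP=> x y _; rewrite in_rest => /and3P[->].
  by move: leA le_tn le_dt le_st; clear; lia.
elim: m => // m IH P C cfg; rewrite ltnS => le_m.
(* The weight n makes the excess dominate the length of P, which is below n. *)
have lower P' C' : config P' C' -> excess P' C' < excess P C ->
    has_multipartite e A [:: d; t; s].
  move=> cfg' lt_ex; apply: IH (cfg') _; apply: leq_trans le_m.
  case: (cfg') => UP' pP' _ _ _; have lt_n := no_path UP' pP'.
  apply: leq_trans (leq_addr _ _); apply: (@leq_trans ((excess P' C').+1 * n)).
    by rewrite mulSn addnC -addSn leq_add2r.
  by rewrite leq_mul2r lt_ex orbT.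
have [UP pP PA [CA sC] tC] := cfg.
have lt_n := no_path UP pP.
have [ltC|leC] := ltnP t #|C|; last first.
  have eqC : #|C| = t by apply/eqP; rewrite eqn_leq leC.
  have [big0|[x xbig]] := set_0Vmem (big P C); last first.
    by have [] := swap_config t_gt0 cfg eqC xbig; apply: lower.
  have cR : #|A| = #|C| + size P + #|rest P C|.
    have -> : size P = #|[set x in P]| by rewrite cardsE (card_uniqP UP).
    rewrite /rest -(cardsID (C :|: [set x in P]) A).
    congr (_ + _); rewrite (setIidPr _); last first.
      by rewrite subUset CA; apply/subsetP=> x; rewrite inE => /PA/setDP[].
    rewrite cardsU (_ : C :&: _ = set0) ?cards0 ?subn0 //.
    apply/setP=> x; rewrite !inE; apply/negP=> /andP[xC /PA].
    by rewrite inE xC.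
  have [||x xr|X clX /andP[leX Xle]] := @greedy_closed (rest P C) d t => //.
  - rewrite (leq_trans t_gt0 le_td) /=.
    move: cR leA lt_n le_tn le_dn t_gt0 le_td; rewrite eqC.
    by move: (#|rest P C|) (#|A|) (size P) => r a p; clear; lia.
  - rewrite leqNgt; apply/negP=> lt_x.
    by have: x \in big P C; [rewrite inE xr | rewrite big0 inE].
  have /andP[Xr sX] := clX.
  have rA : rest P C \subset A := subsetDl _ _.
  have rC : [disjoint C & rest P C].
    by rewrite disjoint_sym disjoints_subset /rest setDE subIset // setCU subsetIl orbT.
  have aC (B : {set T}) : B \subset rest P C -> apart C B.
    move=> Br; apply: apartS (subxx _) Br _.
    by apply/andP.
  apply: (has_multipartite3 (B1 := X) (B2 := C) (B3 := rest P C :\: X)).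
  - by split; [exact: subset_trans Xr rA | | exact: subset_trans (subsetDl _ _) rA].
  - split=> //; rewrite cardsD (setIidPr Xr).
    move: cR leA lt_n le_tn le_dn Xle; rewrite eqC.
    by move: (#|rest P C|) (#|A|) (size P) (#|X|) => r a p x; clear; lia.
  - split; last exact/aC/subsetDl.
      have /andP[dC sC'] := aC X Xr; apply/andP; split; first by rewrite disjoint_sym.
      exact: separatedC.
    by apply/andP; split=> //; rewrite disjoint_sym disjoints_subset setDE subsetIr.
have pushP Q z : z \in C -> {subset P <= Q} -> {subset Q <= A :\: C} -> uniq Q ->
    sorted e (z :: Q) -> has_multipartite e A [:: d; t; s].
  by move=> zC PQ QA UQ pQ; have [] := push_config cfg ltC zC PQ QA UQ pQ; apply: lower.
case defP: P => [|p P'].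
  have /card_gt0P[z zC] : 0 < #|C| by apply: leq_trans ltC.
  by apply: (pushP [::] z) => //; rewrite defP.
have nP : P != [::] by rewrite defP.
have [w [z [wP zC ewz]]] := config_contact cA nP t_gt0 cfg.
have cycP R : cycle e (P ++ R) -> uniq (P ++ R) -> {subset R <= rest P C} ->
    has_multipartite e A [:: d; t; s].
  move=> cyc UR Rr; have [Q [PQ QA UQ pQ]] := cycle_contact cfg cyc UR Rr wP zC ewz.
  exact: pushP zC PQ QA UQ pQ.
have endP x P1 : config (x :: P1) C -> rest (x :: P1) C = rest P C ->
    {subset P <= x :: P1} -> size P = (size P1).+1 ->
    has_multipartite e A [:: d; t; s] \/
    (forall z, z \in C -> ~~ e x z) /\ t < #|comp (x |: rest P C) x|.
  move=> cfg1 eqr sP szP; case: (cfg1) => UP1 pP1 PA1 _ _.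
  have [/exists_inP[y yC exy]|/exists_inPn none] := boolP [exists y in C, e x y].
    by left; apply: (pushP (x :: P1) y) => //=; rewrite e_sym exy.
  have [lt_t|le_t] := ltnP t #|comp (x |: rest P C) x|; first by right.
  left; have [||cfg2] := pop_config cfg1; rewrite ?eqr //.
  rewrite {2}/excess /big eqr => le_ex; apply: IH cfg2 _.
  apply: leq_trans le_m; rewrite szP addnS ltnS leq_add2r.
  by rewrite leq_mul2r le_ex orbT.
pose q := last p P'.
have cfg_rev : config (rev P) C /\ rest (rev P) C = rest P C.
  have eqr : rest (rev P) C = rest P C.
    by apply/setP=> x; rewrite !in_rest mem_rev.
  rewrite /config eqr rev_uniq rev_sorted; split=> //; split=> //.
    by rewrite (eq_sorted (e' := e)) // => x y; exact: e_sym.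
  by move=> x; rewrite mem_rev; apply: PA.
have revP : rev P = q :: rev (belast p P') by rewrite defP lastI rev_rcons.
have [//|[pC ltKp]] : has_multipartite e A [:: d; t; s] \/
    (forall z, z \in C -> ~~ e p z) /\ t < #|comp (p |: rest P C) p|.
  by apply: (endP p P'); rewrite -?defP // defP.
have [//|[qC ltKq]] : has_multipartite e A [:: d; t; s] \/
    (forall z, z \in C -> ~~ e q z) /\ t < #|comp (q |: rest P C) q|.
  case: cfg_rev; rewrite revP => cfg1 eqr; apply: (endP q (rev (belast p P'))) => //.
    by move=> x; rewrite -revP mem_rev.
  by rewrite size_rev size_belast defP.
have npq : p != q.
  apply: contraTneq ewz => eqpq; suff eqw : w = p by rewrite eqw pC.
  move: UP wP eqpq; rewrite /q defP; case: (P') => [|y P2] /=.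
    by rewrite inE => _ /eqP.
  by move=> + _ eqp; rewrite {1}eqp mem_last.
set Kp := comp _ p in ltKp; set Kq := comp _ q in ltKq.
pose W := p |: (q |: rest P C).
have KpW : Kp \subset comp W p.
  apply: comp_sub; apply: subset_trans (comp_in _) _; first exact: setU11.
  by apply: setUS; apply: subsetUr.
have KqW : Kq \subset comp W q.
  by apply: comp_sub; apply: subset_trans (comp_in _) (subsetUr _ _); exact: setU11.
have pW : p \in W := setU11 _ _.
have qW : q \in W by rewrite !inE eqxx orbT.
have [aK|naK] := boolP (apart Kp Kq); last first.
  have qp : q \in comp W p.
    have [x [y [xK yK xy]]] : exists x y, [/\ x \in Kp, y \in Kq & x = y \/ e x y].
      move: naK; rewrite negb_and => /orP[].
        case/pred0Pn=> x /andP[xKp xKq]; exists x, x; split=> //; by left.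
      case/forall_inPn=> x xK /forall_inPn[y yK]; rewrite negbK => exy.
      by exists x, y; split=> //; right.
    move/(subsetP KpW): xK => xK; move/(subsetP KqW): yK => yK.
    have yKp : y \in comp W p.
      case: xy => [<-//|exy].
      exact: comp_step xK (subsetP (comp_in pW) x xK) (subsetP (comp_in qW) y yK) exy.
    by rewrite -(comp_eq yKp) (comp_eq yK) comp_refl.
  have [||||R []] := @close_cycle p P' C; rewrite -?defP //.
  exact: cycP.
have sub_end x : x \in P -> comp (x |: rest P C) x \subset A.
  move=> xP; apply: subset_trans (comp_in (setU11 _ _)) _.
  rewrite subUset sub1set subsetDl andbT; by have /setDP[] := PA x xP.
have apart_end x : x \in P -> (forall z, z \in C -> ~~ e x z) ->
    apart (comp (x |: rest P C) x) C.
  move=> xP xC; apply: apartS (comp_in (setU11 _ _)) (subxx _) _; apply/andP; split.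
    rewrite disjoints_subset subUset sub1set inE; have /setDP[_ ->] := PA x xP.
    by rewrite /rest setDE subIset // setCU subsetIl orbT.
  apply/separatedP=> u v /setU1P[->|ur] vC; first exact: xC.
  by rewrite e_sym; move/separatedP: sC; apply.
have pP0 : p \in P by rewrite defP mem_head.
have qP0 : q \in P by rewrite defP mem_last.
apply: (has_multipartite3 (B1 := Kp) (B2 := Kq) (B3 := C)).
- by split=> //; exact: sub_end.
- by split; [exact: leq_trans ltKp | exact: ltnW | exact: leq_trans ltC].
- by split=> //; exact: apart_end.
Qed.
End Tripartite.

(** * Weaving *)

Lemma all_zip_catr (S T : Type) (p : pred (S * T)) X Y1 Y2 :
  all p (zip X (Y1 ++ Y2)) = all p (zip X Y1) && all p (zip (drop (size Y1) X) Y2).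
Proof.
elim: Y1 X => [|y Y1 IH] X /=; first by rewrite drop0; case: X.
by case: X => [|x X] /=; [case: (Y2) | rewrite IH andbA].
Qed.

Lemma all_zip_catl (S T : Type) (p : pred (S * T)) X1 X2 Y :
  all p (zip (X1 ++ X2) Y) = all p (zip X1 Y) && all p (zip X2 (drop (size X1) Y)).
Proof.
elim: X1 Y => [|x X1 IH] Y /=; first by rewrite drop0; case: Y.
by case: Y => [|y Y] /=; [case: (X2) | rewrite IH andbA].
Qed.

Lemma zip_mem (S T : eqType) (X : seq S) (Y : seq T) c :
  c \in zip X Y -> (c.1 \in X) && (c.2 \in Y).
Proof.
elim: X Y => [|x X IH] [|y Y] //=; rewrite inE => /orP[/eqP-> /=|/IH].
  by rewrite !inE !eqxx.
by rewrite !inE => /andP[-> ->]; rewrite !orbT.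
Qed.

Fixpoint evens (T : Type) (p : seq T) : seq T :=
  match p with
  | x :: _ :: p' => x :: evens p'
  | _ => p
  end.

Fixpoint odds (T : Type) (p : seq T) : seq T :=
  if p is _ :: y :: p' then y :: odds p' else [::].

Lemma size_evens (T : Type) (p : seq T) : size (evens p) = uphalf (size p).
Proof. by elim/pair_ind: p => //= x y p ->. Qed.

Lemma size_odds (T : Type) (p : seq T) : size (odds p) = (size p)./2.
Proof. by elim/pair_ind: p => //= x y p ->. Qed.

Lemma perm_evens_odds (T : eqType) (p : seq T) : perm_eq (evens p ++ odds p) p.
Proof.
elim/pair_ind: p => //= x y p IH; rewrite perm_cons.
by rewrite -cat1s perm_catCA /= perm_cons.
Qed.

Lemma sorted_evens_odds (T : Type) (r : rel T) (p : seq T) :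
  symmetric r -> sorted r p ->
  all (fun c => r c.1 c.2) (zip (evens p) (odds p)) &&
  all (fun c => r c.1 c.2) (zip (odds p) (behead (evens p))).
Proof.
move=> r_sym; elim/pair_ind: p => // x y p IH /= /andP[-> pyp].
have /andP[-> +] := IH (path_sorted pyp).
by case: p {IH} pyp => [|z [|u p]] //= /andP[-> _].
Qed.

Section Weave.
Variables (T : finType) (e : rel T).
Hypothesis e_sym : symmetric e.

(** The condition on a row [X] and a later row [Y] of the table, where [Y] begins in
    column [o]: entries of [Y] are not adjacent to the entries of [X] in the same and in
    the next column. *)
Definition zigzag (o : nat) (X Y : seq T) : bool :=
  all (fun c => ~~ e c.1 c.2) (zip (drop o X) Y ++ zip Y (drop o.+1 X)).

(** [Xs] are the full rows, in their order, and [Y] is the last row. *)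
Definition woven (A : {set T}) (D : seq nat) (o s : nat) : Prop :=
  exists Xs Y, [/\ shape Xs = D, size Y = s,
    uniq (flatten Xs ++ Y) /\ {subset flatten Xs ++ Y <= A},
    pairwise (zigzag 0) Xs & all (zigzag o ^~ Y) Xs].

Lemma zigzag_blue o X Y :
  (forall x y, x \in X -> y \in Y -> ~~ e x y) -> zigzag o X Y.
Proof.
move=> blue; rewrite /zigzag all_cat; apply/andP; split; apply/allP=> -[x y] /zip_mem /=.
  by case/andP=> /mem_drop xX yY; apply: blue.
by case/andP=> xY /mem_drop yX; rewrite e_sym blue.
Qed.

Lemma zigzag_cat o X Y1 Y2 :
  zigzag o X (Y1 ++ Y2) = zigzag o X Y1 && zigzag (o + size Y1) X Y2.
Proof.
rewrite /zigzag !all_cat all_zip_catr all_zip_catl !drop_drop.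
by rewrite addnS [size Y1 + o]addnC -!andbA; do !bool_congr.
Qed.

Lemma wovenS (A B : {set T}) D o s : B \subset A -> woven B D o s -> woven A D o s.
Proof.
move=> /subsetP BA [Xs [Y [sX sY [U S] pX aX]]]; exists Xs, Y; split=> //.
by split=> // x /S/BA.
Qed.

Lemma zigzag_enum o (X Y : {set T}) : separated e X Y -> zigzag o (enum X) (enum Y).
Proof.
move/separatedP=> sXY; apply: zigzag_blue => x y; rewrite !mem_enum; exact: sXY.
Qed.

Lemma uniq_flatten_enum (Ss : seq {set T}) :
  pairwise (apart e) Ss -> uniq (flatten [seq enum (X : {set T}) | X <- Ss]).
Proof.
elim: Ss => //= X Ss IH /andP[aX /IH U]; rewrite cat_uniq enum_uniq U andbT /=.
apply/hasPn=> x /flattenP[_ /mapP[Z ZS ->]]; rewrite !mem_enum => xZ.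
have /andP[dXZ _] := allP aX Z ZS.
by rewrite (disjointFl dXZ).
Qed.

Lemma woven_multipartite A D o s : has_multipartite e A (rcons D s) -> woven A D o s.
Proof.
case=> Ss [cS sS pS]; case/lastP: Ss cS sS pS => [|Ss W]; first by case: D.
rewrite map_rcons all_rcons => /rcons_inj[cS cW] /andP[WA sS] pS.
pose Xs := [seq enum (X : {set T}) | X <- Ss].
have flatE : flatten Xs ++ enum W = flatten [seq enum (X : {set T}) | X <- rcons Ss W].
  by rewrite map_rcons flatten_rcons.
exists Xs, (enum W); split.
- by rewrite -cS /shape -map_comp; apply: eq_map => X /=; rewrite -cardE.
- by rewrite -cardE.
- rewrite flatE; split; first exact: uniq_flatten_enum.
  move=> x /flattenP[_ /mapP[Z ZS ->]]; rewrite mem_enum => xZ.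
  move: ZS; rewrite mem_rcons inE => /orP[/eqP eqZ|ZS].
    by apply: (subsetP WA); rewrite -eqZ.
  exact: (subsetP (allP sS Z ZS)).
- move: pS; rewrite pairwise_rcons => /andP[_]; rewrite pairwise_map.
  by apply: sub_pairwise => X Y /andP[_]; apply: zigzag_enum.
rewrite all_map; move: pS; rewrite pairwise_rcons => /andP[+ _].
by apply: sub_all => X /andP[_]; apply: zigzag_enum.
Qed.

Variables (B C : {set T}).
Hypothesis aBC : apart e B C.

Lemma blueBC x y : x \in B -> y \in C -> ~~ e x y.
Proof. by case/andP: aBC => _ /separatedP; apply. Qed.

Lemma notBC x : x \in B -> x \notin C.
Proof. by case/andP: aBC => dBC _ xB; rewrite (disjointFr dBC). Qed.

Lemma uniq_catBC X Y : uniq X -> uniq Y -> {subset X <= B} -> {subset Y <= C} ->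
  uniq (X ++ Y).
Proof.
move=> UX UY XB YC; rewrite cat_uniq UX UY andbT; apply/hasPn=> y /YC yC.
by apply/negP=> /XB/notBC; rewrite yC.
Qed.

Lemma zigzagBC o X Y : {subset X <= B} -> {subset Y <= C} -> zigzag o X Y.
Proof. by move=> XB YC; apply: zigzag_blue => x y /XB xB /YC; apply: blueBC. Qed.

Lemma zigzagCB o X Y : {subset X <= C} -> {subset Y <= B} -> zigzag o X Y.
Proof.
by move=> XC YB; apply: zigzag_blue => x y /XC xC /YB yB; rewrite e_sym blueBC.
Qed.

Lemma sub_flatten (Xs : seq (seq T)) Y (A : {set T}) :
  {subset flatten Xs ++ Y <= A} ->
  {subset Y <= A} /\ forall X, X \in Xs -> {subset X <= A}.
Proof.
move=> sA; split=> [y yY|X XXs x xX]; apply: sA; rewrite mem_cat ?yY ?orbT //.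
by apply/orP; left; apply/flattenP; exists X.
Qed.

(** The short row of [C] is placed after that of [B], so it begins in column [o + s]. *)
Lemma woven_cat D1 D2 o s t :
  woven B D1 o s -> woven C D2 (o + s) t -> woven (B :|: C) (D1 ++ D2) o (s + t).
Proof.
move=> [Xs [X [sXs sX [UX SX] pX aX]]] [Ys [Y [sYs sY [UY SY] pY aY]]].
have [[XB XsB] [YC YsC]] := (sub_flatten SX, sub_flatten SY).
exists (Xs ++ Ys), (X ++ Y).
have permE : perm_eq (flatten (Xs ++ Ys) ++ X ++ Y)
                   ((flatten Xs ++ X) ++ (flatten Ys ++ Y)).
  by rewrite flatten_cat -!catA perm_cat2l perm_catCA.
split.
- by rewrite /shape map_cat -!/(shape _) sXs sYs.
- by rewrite size_cat sX sY.
- split; first by rewrite (perm_uniq permE) uniq_catBC.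
  by move=> x; rewrite (perm_mem permE) mem_cat inE => /orP[/SX->|/SY->]; rewrite ?orbT.
- rewrite pairwise_cat pX pY !andbT; apply/allrelP=> Z1 Z2 Z1X Z2Y.
  by apply: zigzagBC; [exact: XsB | exact: YsC].
rewrite all_cat; apply/andP; split; apply/allP=> Z ZXs; rewrite zigzag_cat.
  by rewrite (allP aX) //= zigzagBC //; exact: XsB.
by rewrite sX (allP aY) // andbT zigzagCB //; exact: YsC.
Qed.

(** The last row found in [B] becomes a full row, placed between those of [B] and [C]. *)
Lemma woven_insert D1 D2 d o s :
  woven B D1 0 d -> woven C D2 o s -> woven (B :|: C) (D1 ++ d :: D2) o s.
Proof.
move=> [Xs [X [sXs sX [UX SX] pX aX]]] [Ys [Y [sYs sY [UY SY] pY aY]]].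
have [[XB XsB] [YC YsC]] := (sub_flatten SX, sub_flatten SY).
exists (Xs ++ X :: Ys), Y.
have flatE : flatten (Xs ++ X :: Ys) ++ Y = (flatten Xs ++ X) ++ (flatten Ys ++ Y).
  by rewrite flatten_cat /= -!catA.
split=> //.
- by rewrite /shape map_cat /= -!/(shape _) sXs sYs sX.
- rewrite flatE; split; first by rewrite uniq_catBC.
  by move=> x; rewrite mem_cat inE => /orP[/SX->|/SY->]; rewrite ?orbT.
- rewrite pairwise_cat pX /= pY !andbT; apply/andP; split.
    apply/allrelP=> Z1 Z2 Z1X; rewrite inE => /orP[/eqP->|Z2Y]; first exact: (allP aX).
    by apply: zigzagBC; [exact: XsB | exact: YsC].
  by apply/allP=> Z ZY; apply: zigzagBC => //; exact: YsC.
rewrite all_cat /= aY andbT; apply/andP; split; last exact: zigzagBC.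
by apply/allP=> Z ZX; apply: zigzagBC => //; exact: XsB.
Qed.

End Weave.

Section Weaving.
Variables (T : finType) (e : rel T) (n : nat).
Hypothesis e_sym : symmetric e.
Hypothesis no_path : forall p, uniq p -> sorted e p -> size p < n.
Hypothesis n_gt1 : 1 < n.

(** A blue path [x0 y0 x1 y1 ...] is a pair of rows in zigzag. It ends with an [x] precisely
    if the row of length [d] continues beyond the last [y]; other entries of that
    row are not adjacent, in the table, to the short row and are arbitrary. *)
Lemma woven1 (A : {set T}) d o s :
  o + s <= d -> d < n -> d + s <= n -> n.-1 + s <= #|A| -> woven e A [:: d] o s.
Proof.
move=> le_os lt_dn le_dsn leA.
pose m := s.*2 + (o + s < d).
have m_half : m./2 = s by rewrite /m addnC half_bit_double.
have m_uphalf : uphalf m = s + (o + s < d).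
  by rewrite uphalf_half m_half addnC /m oddD odd_double oddb.
have le_mn : m <= n by rewrite /m; case: ltnP le_os le_dsn; clear; lia.
have [|[p [Up pp _ sp]]|[p [Up pp pA sp]]] := gerencser_gyarfas (A := A) e_sym n_gt1 le_mn.
- by rewrite m_half.
- by have := no_path Up pp; rewrite sp ltnn.
have ne_sym : symmetric (fun x y => ~~ e x y) by move=> x y; rewrite e_sym.
have /andP[z1 z2] := sorted_evens_odds ne_sym pp.
have sE : size (evens p) = s + (o + s < d) by rewrite size_evens sp.
have sO : size (odds p) = s by rewrite size_odds sp.
pose F := enum (A :\: [set x in p]).
have sF : size F + m = #|A|.
  have -> : m = #|[set x in p]| by rewrite cardsE (card_uniqP Up).
  rewrite -cardE addnC -(cardsID [set x in p] A) (setIidPr _) //.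
  by apply/subsetP=> x; rewrite inE => /pA.
pose F1 := take o F; pose F2 := take (d - o - size (evens p)) (drop o F).
have le_oF : o <= size F.
  move: sF leA lt_dn le_os; rewrite /m.
  by case: ltnP; move: (size F) (#|A|) => f a; clear; lia.
have sF1 : size F1 = o by rewrite size_takel.
have sF2 : size F2 = d - o - size (evens p).
  rewrite size_takel // size_drop sE; move: sF leA lt_dn le_os; rewrite /m.
  by case: ltnP; move: (size F) (#|A|) => f a; clear; lia.
pose X := F1 ++ evens p ++ F2.
have dropX : drop o X = evens p ++ F2 by rewrite -sF1 drop_size_cat.
have permX : perm_eq (flatten [:: X] ++ odds p) ((F1 ++ F2) ++ p).
  rewrite /= cats0 /X -!catA perm_cat2l perm_catCA perm_cat2l.
  exact: perm_evens_odds.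
have F12 : F1 ++ F2 = take (o + (d - o - size (evens p))) F by rewrite takeD.
exists [:: X], (odds p); split=> //.
- rewrite /= !size_cat sF1 sF2 sE.
  by congr [:: _]; case: ltnP le_os; clear; lia.
- split.
    rewrite (perm_uniq permX) F12 cat_uniq Up take_uniq ?enum_uniq //= andbT.
    by apply/hasPn=> x xp; apply/negP=> /mem_take; rewrite mem_enum !inE xp.
  move=> x; rewrite (perm_mem permX) F12 mem_cat => /orP[/mem_take|/pA//].
  by rewrite mem_enum => /setDP[].
rewrite /= andbT /zigzag -addn1 addnC -drop_drop dropX drop1 all_cat.
rewrite all_zip_catl drop_oversize ?sO ?sE ?leq_addr // z1.
rewrite (_ : zip F2 [::] = [::]) ?andbT /=; last by case: (F2).
case: ltnP sE sF2 le_os => [_ sE _ _|le_d sE sF2 le_os].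
  case: (evens p) sE z2 => [|x E] /=; first by rewrite addn1.
  rewrite addn1 => -[sE] z2; rewrite all_zip_catr.
  by rewrite z2 drop_oversize ?sO ?sE //; case: (F2).
have -> : F2 = [::].
  by apply: size0nil; rewrite sF2 sE; move: le_d le_os; clear; lia.
by rewrite cats0.
Qed.

(** What a part of the table with full rows [D] and a last row of length [s] satisfies.
    The whole table has [n] entries and, besides the rows in [D], a row with at
    least [f] entries; hence the bound on [sumn D + f]. *)
Definition admissible (f : nat) (D : seq nat) (o s : nat) : bool :=
  [&& all (fun d => f <= d <= f.+1) D, pairwise geq D, all (fun d => o + s <= d) D,
      sumn D + f <= n & sumn D + s <= n].

Lemma admissible_cat f D1 D2 o s t : admissible f (D1 ++ D2) o (s + t) ->
  admissible f D1 o s /\ admissible f D2 (o + s) t.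
Proof.
rewrite /admissible !all_cat pairwise_cat !sumn_cat.
case/and5P=> /andP[a1 a2] /and3P[_ p1 p2] /andP[s1 s2] lf ls.
split; apply/and5P; split=> //; try by move: lf ls; clear; lia.
  by apply: sub_all s1 => d; apply: leq_trans; rewrite addnA leq_addr.
by apply: sub_all s2 => d; rewrite addnA.
Qed.

Lemma admissible_insert f D1 D2 d o s : admissible f (D1 ++ d :: D2) o s ->
  admissible f D1 0 d /\ admissible f D2 o s.
Proof.
rewrite /admissible !all_cat pairwise_cat !sumn_cat /=.
case/and5P=> /and3P[a1 _ a2] /and3P[/allrelP ge p1 /andP[_ p2]] /and3P[_ _ s2] lf ls.
split; apply/and5P; split=> //; try by move: lf ls; clear; lia.
by apply/allP=> x xD; apply: ge; rewrite ?mem_head.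
Qed.

Lemma sumn_ge f D : all (fun d => f <= d <= f.+1) D -> f * size D <= sumn D.
Proof.
elim: D => [|d D IH] /=; first by rewrite muln0.
by case/andP=> /andP[le_d _] /IH; rewrite mulnS; apply: leq_add.
Qed.

Lemma admissible_nth2 f D o s i j :
  0 < f -> admissible f D o s -> 1 < size D -> i < size D -> j < size D ->
  nth 0 D i + nth 0 D j <= n.
Proof.
move=> f_gt0 /and5P[/all_nthP aD _ _ lf _] szD lt_i lt_j.
have /andP[_ le_j] := aD 0 j lt_j.
have: all (fun d => f <= d <= f.+1) (take i D ++ drop i.+1 D).
  rewrite all_cat; have: all (fun d => f <= d <= f.+1) D by apply/(all_nthP 0); apply: aD.
  by rewrite -{1}(cat_take_drop i D) (drop_nth 0 lt_i) all_cat /= => /and3P[-> _ ->].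
move/sumn_ge; rewrite size_cat size_takel ?size_drop ?sumn_cat; last exact: ltnW.
move: lf; rewrite -{1}(cat_take_drop i D) (drop_nth 0 lt_i) sumn_cat /= => lf le_sum.
have : f <= f * (i + (size D - i.+1)).
  by rewrite leq_pmulr //; move: szD lt_i; clear; lia.
by move: lf le_sum le_j f_gt0; clear; lia.
Qed.

(** The rows are distributed over [B] and [C] in their given order, because [zigzag] is
    not symmetric in the two rows and the lengths must not increase. *)
Lemma weaving f D o s (A : {set T}) :
  0 < f -> admissible f D o s -> n.-1 * size D + s <= #|A| -> woven e A D o s.
Proof.
move=> f_gt0; have [N] := ubnP #|A|; elim: N A D o s => // N IH A D o s ltN adm leA.
have mono (B : {set T}) : B \proper A -> n.-1 * size D + s <= #|B| -> woven e A D o s.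
  move=> BA leB; apply: (wovenS (proper_sub BA)); apply: IH => //.
  exact: leq_trans (proper_card BA) ltN.
case: D adm leA mono => [|d1 [|d2 D]] adm leA mono.
- by apply: woven_multipartite => //; apply: has_multipartite1; move: leA; rewrite muln0.
- move: adm leA => /and5P[/= /andP[/andP[le_f1 le_f2] _] _ /andP[le_os _] lf ls].
  rewrite muln1 => leA; apply: woven1 => //; move: lf ls f_gt0; clear; lia.
have le_sn : s <= n.-1.
  by case/and5P: adm => /= /andP[/andP[le_f _] _] _ _ _ + ; move: le_f f_gt0; clear; lia.
have [cA|] := boolP (connected e A).
  case: D adm leA {mono} => [|d3 D] adm leA; apply: woven_multipartite => //.
    move: adm => /and5P[/= /and3P[Hd1 Hd2 _] /andP[/andP[ge12 _] _]].
    case/and3P=> _ le_s2 _ lf ls.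
    by apply: (connected_tripartite e_sym no_path) => //;
      move: Hd1 Hd2 ge12 le_s2 lf f_gt0; rewrite /geq /=; clear; lia.
  apply: (connected_multipartite e_sym no_path) => //.
  by case/and5P: adm => _ _ _ lf _; apply: leq_trans lf; rewrite leq_addr.
case/forallPn=> B; rewrite negb_imply => /andP[/and3P[BA nB0 sB] nBA].
pose C := A :\: B; set Ds := [:: d1, d2 & D] in adm leA mono *.
pose k := size Ds.
have aBC : apart e B C.
  by rewrite /apart sB disjoint_sym disjoints_subset /C setDE subsetIr.
have aCB : apart e C B.
  by case/andP: aBC => dBC sBC; rewrite /apart disjoint_sym dBC separatedC.
have BCA : B :|: C = A.
  by apply/setP=> x; rewrite !inE; case: (boolP (x \in B)) => // /(subsetP BA)->.
have CBA : C :|: B = A by rewrite setUC.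
have pBA : B \proper A by rewrite properEneq nBA.
have cA : #|A| = #|B| + #|C| by rewrite -(cardsID B A) (setIidPr BA).
have B_gt0 : 0 < #|B| by rewrite card_gt0.
have ltB : #|B| < N by apply: leq_trans (proper_card pBA) _; rewrite -ltnS.
have ltC : #|C| < N by move: ltN; rewrite cA; move: B_gt0; clear; lia.
pose i := #|B| %/ n.-1; pose s0 := #|B| %% n.-1.
have defB : #|B| = n.-1 * i + s0 by rewrite mulnC -divn_eq.
have lt_s0 : s0 < n.-1 by rewrite ltn_mod; move: n_gt1; clear; lia.
have [leB|ltB'] := leqP (n.-1 * k + s) #|B|; first exact: mono leB.
have D_take j : take j Ds ++ drop j Ds = Ds by exact: cat_take_drop.
(* B supplies i full rows and s0 entries of the short row. *)
have [le_s0|gt_s0] := leqP s0 s.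
  have le_ik : i <= k.
    rewrite leqNgt; apply/negP=> lt_ki; move: ltB'; rewrite defB.
    have : n.-1 * k.+1 <= n.-1 * i by rewrite leq_mul2l lt_ki orbT.
    by move: le_sn; rewrite mulnS; clear; lia.
  have [] := @admissible_cat f (take i Ds) (drop i Ds) o s0 (s - s0).
    by rewrite D_take subnKC.
  move=> adm1 adm2; rewrite -BCA -(subnKC le_s0) -(D_take i); apply: (woven_cat e_sym aBC).
    by apply: IH => //; rewrite size_takel // defB.
  apply: IH => //; rewrite size_drop -/k.
  have Ek : n.-1 * k = n.-1 * i + n.-1 * (k - i) by rewrite -mulnDr subnKC.
  by move: leA le_s0; rewrite -/k cA defB Ek; clear; lia.
have lt_ik : i < k.
  rewrite ltnNge; apply/negP=> le_ki; move: ltB'; rewrite defB.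
  have : n.-1 * k <= n.-1 * i by rewrite leq_mul2l le_ki orbT.
  by move: gt_s0; clear; lia.
have D_cut j : j < k -> take j Ds ++ nth 0 Ds j :: drop j.+1 Ds = Ds.
  by move=> lt_jk; rewrite -drop_nth // cat_take_drop.
(* The remainder in B supplies a full row if it is large enough. Otherwise the
   remainder in C, which is n.-1 + s - s0, does. *)
have [le_d|gt_d] := leqP (nth 0 Ds i) s0.
  have [] := @admissible_insert f (take i Ds) (drop i.+1 Ds) (nth 0 Ds i) o s.
    by rewrite D_cut.
  move=> adm1 adm2; rewrite -BCA -(D_cut i lt_ik); apply: (woven_insert e_sym aBC).
    by apply: IH => //; rewrite size_takel ?defB ?leq_add2l // ltnW.
  apply: IH => //; rewrite size_drop -/k.
  have Ek : n.-1 * k = n.-1 * i + n.-1 + n.-1 * (k - i.+1).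
    by rewrite -mulnSr -mulnDr subnKC.
  by move: leA lt_s0; rewrite -/k cA defB Ek; clear; lia.
pose j := k.-1 - i.
have lt_jk : j < k.
  by rewrite /j /k /Ds /=; clear; lia.
have [] := @admissible_insert f (take j Ds) (drop j.+1 Ds) (nth 0 Ds j) o s.
  by rewrite D_cut.
move=> adm1 adm2; rewrite -CBA -(D_cut j lt_jk); apply: (woven_insert e_sym aCB).
  apply: IH => //; rewrite size_takel; last exact: ltnW.
  have Ek : n.-1 * k = n.-1 * i + n.-1 * j + n.-1.
    by rewrite -mulnDr -mulnSr; congr (_ * _); move: lt_ik; rewrite /j; clear; lia.
  have le_dd : nth 0 Ds i + nth 0 Ds j <= n.
    exact: admissible_nth2 f_gt0 adm _ lt_ik lt_jk.
  by move: leA gt_d le_dd; rewrite -/k cA defB Ek; clear; lia.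
apply: IH => //; rewrite size_drop -/k.
have -> : k - j.+1 = i by move: lt_ik; rewrite /j; clear; lia.
by rewrite defB leq_add2l ltnW.
Qed.
End Weaving.

(** * The two bounds *)

Lemma all_zip_nth (T : Type) (p : pred (T * T)) x0 X Y t :
  all p (zip X Y) -> t < size X -> t < size Y -> p (nth x0 X t, nth x0 Y t).
Proof.
elim: X Y t => [|x X IH] [|y Y] [|t] //= /andP[// _]; exact: IH.
Qed.

Lemma flatten_nth_inj (T : eqType) x0 (Ss : seq (seq T)) i j s t :
  uniq (flatten Ss) -> s < size (nth [::] Ss i) -> t < size (nth [::] Ss j) ->
  nth x0 (nth [::] Ss i) s = nth x0 (nth [::] Ss j) t -> i = j /\ s = t.
Proof.
have in_flat (Rs : seq (seq T)) l u : u < size (nth [::] Rs l) ->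
    nth x0 (nth [::] Rs l) u \in flatten Rs.
  move=> lt_u; apply/flattenP; exists (nth [::] Rs l); last exact: mem_nth.
  by apply: mem_nth; rewrite ltnNge; apply/negP=> /(nth_default [::]) E; rewrite E in lt_u.
elim: Ss i j => [|X Ss IH] [|i] [|j] //=; rewrite cat_uniq;
  move=> /and3P[UX /hasPn XSs USs] lt_s lt_t.
- by move/eqP; rewrite nth_uniq // => /eqP->.
- move=> E; have := XSs _ (in_flat _ _ _ lt_t).
  by rewrite -E /= mem_nth.
- move=> E; have := XSs _ (in_flat _ _ _ lt_s).
  by rewrite E /= mem_nth.
by move=> E; have [-> ->] := IH i j USs lt_s lt_t E.
Qed.

Lemma zigzag0_nth (T : finType) (e : rel T) x0 X Y t :
  zigzag e 0 X Y ->
  (t < size X -> t < size Y -> ~~ e (nth x0 X t) (nth x0 Y t)) /\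
  (t.+1 < size X -> t < size Y -> ~~ e (nth x0 Y t) (nth x0 X t.+1)).
Proof.
rewrite /zigzag drop0 all_cat => /andP[a1 a2]; split=> lt1 lt2.
  exact: (all_zip_nth x0 a1).
have := all_zip_nth x0 a2 lt2; rewrite nth_drop add1n; apply.
by rewrite size_drop; move: lt1; clear; lia.
Qed.

(** Adjacency in the power of a path, read off from columns (quotients) and rows
    (remainders). *)
Lemma block_step k i j : i < j <= i + k ->
  (j %/ k.+1 = i %/ k.+1 /\ i %% k.+1 < j %% k.+1) \/
  (j %/ k.+1 = (i %/ k.+1).+1 /\ j %% k.+1 < i %% k.+1).
Proof.
move=> /andP[lt_ij le_ji].
have le1 : i %/ k.+1 <= j %/ k.+1 by apply: leq_div2r; exact: ltnW.
have le2 : j %/ k.+1 <= (i %/ k.+1).+1.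
  rewrite -ltnS ltn_divLR // mulSn.
  have := ltn_ceil i (ltn0Sn k); rewrite mulnC => lt_i.
  by move: lt_i le_ji; rewrite [k.+1 * _]mulnC; clear; lia.
have Ei := divn_eq i k.+1; have Ej := divn_eq j k.+1.
have [eqd|neqd] := eqVneq (j %/ k.+1) (i %/ k.+1).
  left; split=> //; move: Ei Ej lt_ij; rewrite eqd.
  by move: (_ * _) (_ %% _) (_ %% _); clear; lia.
have eqd : j %/ k.+1 = (i %/ k.+1).+1.
  by apply/eqP; rewrite eqn_leq le2 ltn_neqAle eq_sym neqd.
right; split=> //; move: Ei Ej le_ji; rewrite eqd mulSn.
by move: (_ * _) (_ %% _) (_ %% _); clear; lia.
Qed.

Lemma woven_path_power n k N (c : {set 'I_N} -> bool) :
  let f := n %/ k.+1 in let r := n %% k.+1 in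
  0 < n -> woven (colour_class_rel c true) setT (nseq r f.+1 ++ nseq (k - r) f) 0 f ->
  contains_copy (path_power n k) (colour_class c false).
Proof.
move=> f r n_gt0 [Xs [Y [sXs sY [U _] pX aX]]]; set e := colour_class_rel c true in pX aX.
pose Ss := rcons Xs Y.
have USs : uniq (flatten Ss) by rewrite /Ss flatten_rcons.
have pSs : pairwise (zigzag e 0) Ss by rewrite pairwise_rcons aX pX.
have le_rk : r <= k by rewrite -ltnS ltn_mod.
have szSs : size Ss = k.+1.
  by rewrite size_rcons -(size_map size) -/(shape Xs) sXs size_cat !size_nseq subnKC.
have sz p : p < n -> p %/ k.+1 < size (nth [::] Ss (p %% k.+1)).
  move=> lt_pn; have lt_m : p %% k.+1 < k.+1 by rewrite ltn_mod.
  have -> : size (nth [::] Ss (p %% k.+1)) = nth 0 (shape Ss) (p %% k.+1).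
    by rewrite (nth_map [::]) ?szSs.
  have -> : shape Ss = nseq r f.+1 ++ nseq (k - r).+1 f.
    rewrite /shape map_rcons -/(shape Xs) sXs sY -cats1 -catA; congr (_ ++ _).
    by rewrite -addn1 nseqD.
  rewrite nth_cat size_nseq !nth_nseq.
  have En := divn_eq n k.+1; have Ep := divn_eq p k.+1; rewrite -/f -/r in En.
  have le_pf : p %/ k.+1 <= f by apply: leq_div2r; exact: ltnW.
  case: (ltnP (p %% k.+1) r) => [_|le_rp]; first by rewrite ltnS.
  rewrite ifT; last by move: lt_m le_rp le_rk; clear; lia.
  rewrite ltn_neqAle le_pf andbT; apply/eqP=> Ef.
  by move: lt_pn; rewrite En Ep Ef; move: le_rp; clear; lia.
have [x0 _] : exists x0 : 'I_N, true.
  have := sz 0 n_gt0; rewrite div0n mod0n; case: (nth _ _ _) => // x; by exists x.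
pose pos p := nth x0 (nth [::] Ss (p %% k.+1)) (p %/ k.+1).
have pos_inj p q : p < n -> q < n -> pos p = pos q -> p = q.
  move=> lt_p lt_q /(flatten_nth_inj USs (sz p lt_p) (sz q lt_q))[Em Ed].
  by rewrite (divn_eq p k.+1) (divn_eq q k.+1) Em Ed.
have pos_blue p q : p < q <= p + k -> q < n -> ~~ e (pos p) (pos q).
  move=> pq lt_q; have lt_p : p < n by case/andP: pq => lt_pq _; apply: ltn_trans lt_q.
  have lt_m l : l %% k.+1 < size Ss by rewrite szSs ltn_mod.
  have zz a b : a < b -> b < size Ss -> zigzag e 0 (nth [::] Ss a) (nth [::] Ss b).
    move=> lt_ab lt_b; move/(pairwiseP [::]): pSs; apply=> //.
    exact: ltn_trans lt_b.
  have := sz p lt_p; have := sz q lt_q.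
  case: (block_step pq) => -[Ed lt_mod]; rewrite /pos Ed => sq sp.
    exact: (zigzag0_nth x0 _ (zz _ _ lt_mod (lt_m q))).1.
  have e_symm : symmetric e := @colour_class_sym N c true.
  exact: (zigzag0_nth x0 _ (zz _ _ lt_mod (lt_m p))).2.
exists (fun i : path_power n k => pos i).
  by move=> i j /pos_inj E; apply/val_inj/E; exact: ltn_ord.
move=> i j; rewrite /= /path_power_rel => /andP[d_gt0 d_le].
have blue (a b : 'I_n) : a < b <= a + k -> colour_class_rel c false (pos a) (pos b).
  move=> ab; have := pos_blue a b ab (ltn_ord b).
  have npos : pos a != pos b.
    apply/eqP=> /pos_inj E; have := E (ltn_ord a) (ltn_ord b) => eab.
    by move: ab; rewrite eab ltnn.
  by rewrite /e /colour_class_rel npos /=; case: (c _).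
have [lt_ij|lt_ji|eq_ij] := ltngtP (i : nat) (j : nat).
- by apply: blue; rewrite lt_ij /=; move: d_le; clear -lt_ij; lia.
- rewrite colour_class_sym; apply: blue; rewrite lt_ji /=; move: d_le; clear -lt_ji; lia.
- by move: d_gt0; rewrite eq_ij; clear; lia.
Qed.

Lemma upper_bound n k : 0 < k -> k < n ->
  arrows ((n - 1) * k + n %/ (k + 1)) (path_graph n) (path_power n k).
Proof.
move=> k_gt0 lt_kn c; set N := _ + _ in c *.
pose e := colour_class_rel c true.
have e_sym : symmetric e := @colour_class_sym N c true.
have [/existsP[p /andP[Up pp]]|/existsPn none] :=
  boolP [exists p : n.-tuple 'I_N, uniq p && sorted e p].
  left; have x0 : 'I_N
    by case: (tval p) (size_tuple p) => [|x l] // E; move: lt_kn; rewrite -E.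
  exists (fun i : path_graph n => nth x0 p i).
    move=> i j /eqP; rewrite nth_uniq ?size_tuple //; first by move/eqP/val_inj.
  move/(sortedP x0): pp; rewrite size_tuple => pp i j /= /orP[] /eqP E.
    by rewrite -E; apply: pp; rewrite E.
  by rewrite colour_class_sym -E; apply: pp; rewrite E.
right; have no_path p : uniq p -> sorted e p -> size p < n.
  move=> Up pp; rewrite ltnNge; apply/negP=> le_n.
  have sz : size (take n p) == n by rewrite size_takel.
  by have := none (Tuple sz); rewrite /= take_uniq // take_sorted.
have n_gt1 : 1 < n by apply: leq_ltn_trans lt_kn.
apply: woven_path_power; first exact: ltnW.
set f := n %/ _; set r := n %% _.
have f_gt0 : 0 < f by rewrite divn_gt0.
have le_rk : r <= k by rewrite -ltnS ltn_mod.
apply: (weaving e_sym no_path n_gt1 f_gt0).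
  have En := divn_eq n k.+1; rewrite -/f -/r in En.
  have sumD : sumn (nseq r f.+1 ++ nseq (k - r) f) + f = n.
    rewrite sumn_cat !sumn_nseq [RHS]En.
    have -> : f * k.+1 = f * (k - r) + f * r + f by rewrite -mulnDr subnK // mulnS addnC.
    by rewrite mulSn; move: (f * _) (f * _); clear; lia.
  apply/and5P; split; rewrite ?sumD //.
  - by rewrite all_cat !all_nseq !leqnn leqnSn !orbT.
  - rewrite pairwise_cat; apply/and3P; split.
    + by apply/allrelP=> x y /nseqP[-> _] /nseqP[-> _]; exact: leqnSn.
    + by apply/(pairwiseP 0)=> a b; rewrite !inE size_nseq => la lb _;
        rewrite !nth_nseq la lb /=.
    + by apply/(pairwiseP 0)=> a b; rewrite !inE size_nseq => la lb _;
        rewrite !nth_nseq la lb /=.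
  - by rewrite all_cat !all_nseq add0n leqnSn leqnn !orbT.
by rewrite size_cat !size_nseq subnKC // cardsT card_ord /N subn1 addn1.
Qed.

Lemma lower_bound n k M : 0 < k -> k < n ->
  arrows M (path_graph n) (path_power n k) -> (n - 1) * k + n %/ (k + 1) <= M.
Proof.
move=> k_gt0 lt_kn arr; rewrite leqNgt; apply/negP; rewrite subn1 addn1 => lt_M.
have n1_gt0 : 0 < n.-1 by move: lt_kn k_gt0; clear; lia.
pose part (v : 'I_M) := minn (v %/ n.-1) k.
have part_le v : part v <= k by exact: geq_minr.
have part_lo v : n.-1 * part v <= v.
  by apply: leq_trans (leq_trunc_div v n.-1); rewrite mulnC leq_mul2r geq_minl orbT.
have part_hi v : part v < k -> v < n.-1 * (part v).+1.
  rewrite gtn_min ltnn orbF => lt_q.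
  by rewrite /part (minn_idPl (ltnW lt_q)) mulnC ltn_ceil.
have top_hi (v : 'I_M) : part v = k -> v - n.-1 * k < (n %/ k.+1).-1.
  move=> Ev; have := part_lo v; have := ltn_ord v; move: lt_M.
  by rewrite Ev mulnC; move: (_ * _) (_ %/ _) => a b; clear; lia.
have offset_lt (v : 'I_M) : v - n.-1 * part v < n.-1.
  have [lt_k|ge_k] := ltnP (part v) k.
    by have := part_hi v lt_k; have := part_lo v; rewrite mulnS; clear; lia.
  have Ev : part v = k by apply/eqP; rewrite eqn_leq part_le.
  rewrite Ev; apply: leq_trans (top_hi v Ev) _.
  by rewrite -!subn1 leq_sub2r // leq_div.
(* Vertices are grouped into consecutive intervals of length n - 1, and from
   k * (n - 1) on they all belong to the last part. *)
pose c (S : {set 'I_M}) := [forall x in S, forall y in S, part x == part y].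
have cE x y : c [set x; y] = (part x == part y).
  apply/idP/idP=> [/forall_inP/(_ x)|/eqP E].
    by rewrite !inE eqxx => /(_ isT)/forall_inP/(_ y); rewrite !inE eqxx orbT => /(_ isT).
  apply/forall_inP=> u; rewrite !inE => Hu; apply/forall_inP=> v; rewrite !inE => Hv.
  by case/orP: Hu => /eqP->; case/orP: Hv => /eqP->; rewrite ?E ?eqxx.
case: (arr c) => [] [f f_inj f_edge].
  have n_gt0 : 0 < n by apply: ltn_trans lt_kn.
  pose i0 : path_graph n := Ordinal n_gt0.
  have same (i : path_graph n) : part (f i) = part (f i0).
    case: i => m; elim: m => [|m IH] lt_m; first by congr (part (f _)); apply: val_inj.
    rewrite -(IH (ltnW lt_m)).
    have /f_edge : @sedge (path_graph n) (Ordinal (ltnW lt_m)) (Ordinal lt_m).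
      by rewrite /= /path_rel /= eqxx.
    by rewrite /= /colour_class_rel cE eqb_id => /andP[_ /eqP->].
  pose g (i : path_graph n) := Ordinal (offset_lt (f i)).
  have g_inj : injective g.
    move=> i j [] E; apply: f_inj; apply: val_inj; rewrite /=.
    have := part_lo (f i); have := part_lo (f j); move: E; rewrite !same.
    by move: (n.-1 * _); clear; lia.
  by have := leq_card g g_inj; rewrite !card_ord leqNgt ltn_predL n_gt0.
have block (t : 'I_(n %/ k.+1)) : exists i : 'I_n, (i %/ k.+1 == t) && (part (f i) == k).
  have lt_n (s : 'I_k.+1) : t * k.+1 + s < n.
    apply: leq_trans (leq_trunc_div n k.+1).
    apply: (@leq_trans (t.+1 * k.+1)); first by rewrite mulSn addnC ltn_add2r.
    by rewrite leq_mul2r ltn_ord orbT.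
  pose h (s : 'I_k.+1) : 'I_k.+1 := inord (part (f (Ordinal (lt_n s)))).
  have h_inj : injective h.
    move=> s s' /(congr1 val); rewrite /= !inordK ?ltnS ?part_le // => E.
    apply/eqP; apply: contraT => nss.
    have /f_edge : @sedge (path_power n k) (Ordinal (lt_n s)) (Ordinal (lt_n s')).
      rewrite /= /path_power_rel /=.
      have := ltn_ord s; have := ltn_ord s'; move: nss; rewrite -val_eqE /=.
      by move: (t * _) (val s) (val s'); clear; lia.
    by rewrite /= /colour_class_rel cE E eqxx andbF.
  have [h' _ hK] := injF_bij h_inj.
  have Es := hK ord_max; exists (Ordinal (lt_n (h' ord_max))); apply/andP; split.
    by rewrite /= divnMDl // (divn_small (ltn_ord (h' ord_max))) addn0.
  by move/(congr1 val): Es; rewrite /= inordK ?ltnS ?part_le // => ->.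
have top_i t : f (xchoose (block t)) - n.-1 * k < (n %/ k.+1).-1.
  by apply: top_hi; have /andP[_ /eqP] := xchooseP (block t).
pose g t := Ordinal (top_i t).
have g_inj : injective g.
  move=> t t' [] E; apply: val_inj.
  have /andP[/eqP Et /eqP pt] := xchooseP (block t).
  have /andP[/eqP Et' /eqP pt'] := xchooseP (block t').
  rewrite /= -Et -Et'; congr (_ %/ _); congr (val _).
  apply: f_inj; apply: val_inj => /=.
  have := part_lo (f (xchoose (block t))); have := part_lo (f (xchoose (block t'))).
  by move: E; rewrite pt pt'; move: (n.-1 * _); clear; lia.
have := leq_card g g_inj; rewrite !card_ord leqNgt ltn_predL.
by rewrite divn_gt0 // lt_kn.
Qed.

Unset Implicit Arguments.

Theorem theorem1p11 (k n : nat) (hk : 1 <= k) (hn : k + 1 <= n) :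
  is_ramsey_number (path_graph n) (path_power n k)
    ((n - 1) * k + n %/ (k + 1)).
Proof.
have lt_kn : k < n by rewrite -addn1.
by split=> [|M]; [apply: upper_bound | apply: lower_bound].
Qed.
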